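(* Let $\mathbb{K}$ be an arbitrary field, $G$ an abelian group, $g\in G$ with $g^2\ne1$, and consider the $G$-grading $\Gamma(g,g^{-1})$ on $\mathrm{UT}_3^{(-)}(\mathbb{K})$. Then $\mathrm{Id}_G(\mathrm{UT}_3^{(-)},\Gamma(g,g^{-1}))$ is generated, as a $T_G$-ideal, by (i) $x_l$, for $l\notin\mathrm{Supp}\,\Gamma(g,g^{-1})$; (ii) $[x_{1,l},x_{2,l}]$, for $l\in\{g,g^{-1}\}$; (iii) $[x_{1,l},x_{1,h},x_{2,l}]$, for $l,h\in\{g,g^{-1}\}$, $l\ne h$; (iv) $[y_1,y_2,x_l]$, for $l\in\{g,g^{-1}\}$; (v) $\mathrm{Id}(\mathrm{UT}_2^{(-)})\cap\mathcal{L}(Y)$; and, in addition, if $\mathbb{K}$ is finite containing $q$ elements, (vi) $[x_l,y^{(q)}]-[x_l,y]$, for $l\in\{g,g^{-1}\}$. Moreover, a basis of the relatively free algebra $\mathcal{L}(X^G)$ modulo $\mathrm{Id}_G(\mathrm{UT}_3^{(-)},\Gamma(g,g^{-1}))$ is given by a basis of the relatively free algebra of $\mathrm{UT}_2(\mathbb{K})^{(-)}$ in the variables $Y$ together with all polynomials $$[x_l,y_1^{(p_1)},\ldots,y_r^{(p_r)}],\qquad [[x_g,y_1^{(p_1)},\ldots,y_r^{(p_r)}],[x_{g^{-1}},y_1^{(q_1)},\ldots,y_r^{(q_r)}]],$$ where $l\in\{g,g^{-1}\}$, $r\ge0$, and $0\le p_\ell,q_\ell<|\mathbb{K}|$ for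 each $\ell\in\{1,\ldots,r\}$ (no upper bound if $\mathbb{K}$ is infinite), and where $x_l$, $x_g$, $x_{g^{-1}}$ range over all variables of the indicated degrees.
   Context: $\mathrm{UT}_n^{(-)}=\mathrm{UT}_n(\mathbb{K})^{(-)}$ is the Lie algebra of upper triangular $n\times n$ matrices over $\mathbb{K}$ with bracket $[a,b]=ab-ba$; $e_{ij}$ are matrix units. For an abelian group $G$ (multiplicative, neutral element $1$) and $g,h\in G$, $\Gamma(g,h)$ is the $G$-grading on $\mathrm{UT}_3^{(-)}$ with $\deg e_{ii}=1$, $\deg e_{12}=g$, $\deg e_{23}=h$, $\deg e_{13}=gh$; $\mathrm{Supp}$ denotes its support. $\mathcal{L}(X^G)$ is the free $G$-graded Lie algebra over $\mathbb{K}$ freely generated by $X^G=\{x_{i,g}\mid i\in\mathbb{N},g\in G\}$ with $\deg x_{i,g}=g$. A symbol $x_l$ denotes a variable of degree $l$; $y,y_1,y_2,\ldots$ denote variables of trivial degree $1$ ($y_i=x_{i,1}$), $Y=\{y_1,y_2,\ldots\}$, and $\mathcal{L}(Y)$ is the free Lie algebra on $Y$. Commutators are left-normed, and $[x,y^{(m)}]=[x,y,\ldots,y]$ with $y$ repeated $m$ times. $\mathrm{Id}_G(\mathrm{UT}_3^{(-)},\Gamma)$ is the set of $f\in\mathcal{L}(X^G)$ that vanish under every graded homomorphism $\mathcal{L}(X^G)\to(\mathrm{UT}_3^{(-)},\Gamma)$. A $T_G$-ideal is an ideal of $\mathcal{L}(X^G)$ invariant under all graded endomorphisms. $\mathrm{Id}(\mathrm{UT}_2^{(-)})\cap\mathcal{L}(Y)$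 is the ideal of ordinary Lie polynomial identities of $\mathrm{UT}_2(\mathbb{K})^{(-)}$ in the variables $Y$; a basis of the relatively free algebra of $\mathrm{UT}_2(\mathbb{K})^{(-)}$ in the variables $Y$ is a set of elements of $\mathcal{L}(Y)$ whose images form a basis of $\mathcal{L}(Y)/(\mathrm{Id}(\mathrm{UT}_2^{(-)})\cap\mathcal{L}(Y))$. *)

(* Defs.v *)
From HB Require Import structures.
From mathcomp Require Import all_boot all_order all_algebra.
From mathcomp Require Import generic_quotient.
From mathcomp Require Import ring.
From mathcomp Require Import boolp classical_sets functions cardinality.

Set Implicit Arguments.
Unset Strict Implicit.
Unset Printing Implicit Defensive.

Import GRing.Theory.
Local Open Scope ring_scope.
Local Open Scope classical_set_scope.
Local Open Scope card_scope.
Local Open Scope quotient_scope.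

HB.mixin Record isLieAlgebra (K : fieldType) L of GRing.Lmodule K L := {
  lie : L -> L -> L;
  liePl : forall (c : K) a b z, lie (c *: a + b) z = c *: lie a z + lie b z;
  liePr : forall (c : K) z a b, lie z (c *: a + b) = c *: lie z a + lie z b;
  liexx : forall a, lie a a = 0;
  lie_jacobi : forall a b c,
    lie (lie a b) c + lie (lie b c) a + lie (lie c a) b = 0
}.

#[short(type="lieAlgType")]
HB.structure Definition LieAlgebra (K : fieldType) :=
  {L of GRing.Lmodule K L & isLieAlgebra K L}.

Section LieNotions.
Variable K : fieldType.
Implicit Types L : lieAlgType K.

Definition lie_hom L1 L2 (phi : L1 -> L2) : Prop :=
  linear phi /\ (forall a b, phi (lie a b) = lie (phi a) (phi b)).

(* One-sided absorption suffices, the bracket being anticommutative. *)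
Definition lie_ideal L (I : set L) : Prop :=
  [/\ I 0, (forall (c : K) a b, I a -> I b -> I (c *: a + b))
    & (forall a b, I a -> I (lie a b))].

(* [a, b^(m)] *)
Definition lie_pow L (a b : L) (m : nat) : L := iter m (fun u => lie u b) a.

(* The images of the elements of B in L / I are pairwise distinct and form a
   basis of L / I. *)
Definition basis_mod L (I B : set L) : Prop :=
  (forall (s : seq L) (c : L -> K), uniq s -> (forall b, b \in s -> B b) ->
     I (\sum_(b <- s) c b *: b) -> forall b, b \in s -> c b = 0) /\
  (forall f : L, exists (s : seq L) (c : L -> K),
     (forall b, b \in s -> B b) /\ I (f - \sum_(b <- s) c b *: b)).

End LieNotions.

Section UpperTriangular.
Variables (K : fieldType) (n : nat).

Definition is_ut : {pred 'M[K]_n} :=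
  [pred A : 'M[K]_n | [forall i : 'I_n, forall j : 'I_n, (j < i)%N ==> (A i j == 0)]].

Lemma is_utP (A : 'M[K]_n) :
  reflect (forall i j : 'I_n, (j < i)%N -> A i j = 0) (A \in is_ut).
Proof.
apply: (iffP forallP) => [h i j ji|h i].
  by move/forallP: (h i) => /(_ j) /implyP /(_ ji) /eqP.
by apply/forallP => j; apply/implyP => ji; apply/eqP/h.
Qed.

Fact is_ut_submod : submod_closed is_ut.
Proof.
split; first by apply/is_utP => i j _; rewrite mxE.
move=> c A B /is_utP hA /is_utP hB; apply/is_utP => i j ji.
by rewrite !mxE hA // hB // mulr0 addr0.
Qed.
HB.instance Definition _ :=
  GRing.isSubmodClosed.Build K 'M[K]_n is_ut
    is_ut_submod.

Record ut := Ut { ut_val :> 'M[K]_n; ut_valP : ut_val \in is_ut }.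
HB.instance Definition _ := [isSub for ut_val].
HB.instance Definition _ := [Choice of ut by <:].
HB.instance Definition _ := [SubChoice_isSubLmodule of ut by <:].

Fact is_ut_lie (A B : ut) :
  (ut_val A *m ut_val B - ut_val B *m ut_val A) \in is_ut.
Proof.
suff mulut (C D : ut) : ut_val C *m ut_val D \in is_ut.
  by rewrite rpredB ?mulut.
apply/is_utP => i j ji; rewrite mxE big1 // => k _.
case: (ltnP k i) => [ki|ik].
  by rewrite (is_utP _ (ut_valP C)) // mul0r.
by rewrite (is_utP _ (ut_valP D)) ?mulr0 // (leq_trans ji).
Qed.
Definition ut_lie (A B : ut) : ut := Ut (is_ut_lie A B).

Fact ut_liePl (c : K) a b z :
  ut_lie (c *: a + b) z = c *: ut_lie a z + ut_lie b z.
Proof.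
apply: val_inj => /=.
rewrite mulmxDl mulmxDr -scalemxAl -scalemxAr scalerBr.
by rewrite opprD addrACA.
Qed.
Fact ut_liePr (c : K) z a b :
  ut_lie z (c *: a + b) = c *: ut_lie z a + ut_lie z b.
Proof.
apply: val_inj => /=.
rewrite mulmxDl mulmxDr -scalemxAl -scalemxAr scalerBr.
by rewrite opprD addrACA.
Qed.
Fact ut_liexx a : ut_lie a a = 0.
Proof. by apply: val_inj; rewrite /= subrr. Qed.
Fact ut_lie_jacobi a b c :
  ut_lie (ut_lie a b) c + ut_lie (ut_lie b c) a + ut_lie (ut_lie c a) b = 0.
Proof.
apply: val_inj => /=; move: (val a) (val b) (val c) => A B C.
rewrite !mulmxBl !mulmxBr !mulmxA !opprB.
set x1 := A *m B *m C; set x2 := B *m A *m C; set x3 := C *m B *m A.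
set x4 := C *m A *m B; set x5 := B *m C *m A; set x6 := A *m C *m B.
apply/matrixP => i j; rewrite !mxE.
move: (x1 i j) (x2 i j) (x3 i j) (x4 i j) (x5 i j) (x6 i j) => *; ring.
Qed.
HB.instance Definition _ :=
  isLieAlgebra.Build K ut ut_liePl ut_liePr ut_liexx ut_lie_jacobi.

End UpperTriangular.

Section FreeLie.
Variables (K : fieldType) (X : Type).

Inductive lterm : Type :=
| LVar of X
| LZero
| LAdd of lterm & lterm
| LScale of K & lterm
| LBr of lterm & lterm.

HB.instance Definition _ := gen_eqMixin lterm.
HB.instance Definition _ := gen_choiceMixin lterm.

(* The congruence generated by the axioms of Lie algebras over K; the opposite
   of t is LScale (-1) t. *)
Inductive lcong : lterm -> lterm -> Prop :=
| lc_refl t : lcong t t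
| lc_sym t u : lcong t u -> lcong u t
| lc_trans t u v : lcong t u -> lcong u v -> lcong t v
| lc_add t t' u u' : lcong t t' -> lcong u u' -> lcong (LAdd t u) (LAdd t' u')
| lc_scale c t t' : lcong t t' -> lcong (LScale c t) (LScale c t')
| lc_br t t' u u' : lcong t t' -> lcong u u' -> lcong (LBr t u) (LBr t' u')
| lc_addA t u v : lcong (LAdd t (LAdd u v)) (LAdd (LAdd t u) v)
| lc_addC t u : lcong (LAdd t u) (LAdd u t)
| lc_add0 t : lcong (LAdd LZero t) t
| lc_addN t : lcong (LAdd (LScale (-1) t) t) LZero
| lc_scaleA c d t : lcong (LScale c (LScale d t)) (LScale (c * d) t)
| lc_scale1 t : lcong (LScale 1 t) t
| lc_scaleDr c t u :
    lcong (LScale c (LAdd t u)) (LAdd (LScale c t) (LScale c u))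
| lc_scaleDl c d t :
    lcong (LScale (c + d) t) (LAdd (LScale c t) (LScale d t))
| lc_brl c t u v :
    lcong (LBr (LAdd (LScale c t) u) v) (LAdd (LScale c (LBr t v)) (LBr u v))
| lc_brr c t u v :
    lcong (LBr v (LAdd (LScale c t) u)) (LAdd (LScale c (LBr v t)) (LBr v u))
| lc_alt t : lcong (LBr t t) LZero
| lc_jacobi t u v :
    lcong (LAdd (LAdd (LBr (LBr t u) v) (LBr (LBr u v) t)) (LBr (LBr v t) u))
          LZero.

Definition lcongb (t u : lterm) : bool := `[< lcong t u >].

Fact lcongb_refl : reflexive lcongb.
Proof. by move=> t; apply/asboolP; exact: lc_refl. Qed.
Fact lcongb_sym : symmetric lcongb.
Proof. by move=> t u; apply/asboolP/asboolP; exact: lc_sym. Qed.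
Fact lcongb_trans : transitive lcongb.
Proof.
by move=> t u v /asboolP h /asboolP k; apply/asboolP; exact: lc_trans h k.
Qed.
Canonical lcong_equiv := EquivRel lcongb lcongb_refl lcongb_sym lcongb_trans.

Definition freeLie : Type := {eq_quot lcong_equiv}.
HB.instance Definition _ := Choice.on freeLie.
HB.instance Definition _ := Quotient.on freeLie.
HB.instance Definition _ : isEqQuotient lterm lcong_equiv freeLie :=
  EqQuotient.on freeLie.

Lemma fl_eqP (t u : lterm) : \pi_freeLie t = \pi_freeLie u <-> lcong t u.
Proof. by split=> [/eqmodP/asboolP|?]; last exact/eqmodP/asboolP. Qed.

Lemma lcong_repr (t : lterm) : lcong (repr (\pi_freeLie t)) t.
Proof. by apply/fl_eqP; rewrite reprK. Qed.

Definition fl_var (x : X) : freeLie := \pi_freeLie (LVar x).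
Definition fl_zero : freeLie := \pi_freeLie LZero.
Definition fl_add (a b : freeLie) : freeLie := \pi_freeLie (LAdd (repr a) (repr b)).
Definition fl_scale (c : K) (a : freeLie) : freeLie := \pi_freeLie (LScale c (repr a)).
Definition fl_opp : freeLie -> freeLie := fl_scale (-1).
Definition fl_lie (a b : freeLie) : freeLie := \pi_freeLie (LBr (repr a) (repr b)).

Fact fl_piD t u : \pi_freeLie (LAdd t u) = fl_add (\pi t) (\pi u).
Proof. by apply/fl_eqP/lc_sym/lc_add; exact: lcong_repr. Qed.
Fact fl_piZ c t : \pi_freeLie (LScale c t) = fl_scale c (\pi t).
Proof. by apply/fl_eqP/lc_sym/lc_scale; exact: lcong_repr. Qed.
Fact fl_piL t u : \pi_freeLie (LBr t u) = fl_lie (\pi t) (\pi u).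
Proof. by apply/fl_eqP/lc_sym/lc_br; exact: lcong_repr. Qed.
Definition fl_piE := (fl_piD, fl_piZ, fl_piL).

Fact fl_addA : associative fl_add.
Proof.
elim/quotW => t; elim/quotW => u; elim/quotW => v.
rewrite -!fl_piE; apply/fl_eqP; exact: lc_addA.
Qed.
Fact fl_addC : commutative fl_add.
Proof.
elim/quotW => t; elim/quotW => u.
rewrite -!fl_piE; apply/fl_eqP; exact: lc_addC.
Qed.
Fact fl_add0 : left_id fl_zero fl_add.
Proof.
elim/quotW => t; rewrite -!fl_piE; apply/fl_eqP; exact: lc_add0.
Qed.
Fact fl_addN : left_inverse fl_zero fl_opp fl_add.
Proof.
elim/quotW => t; rewrite /fl_opp -!fl_piE; apply/fl_eqP; exact: lc_addN.
Qed.
HB.instance Definition _ :=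
  GRing.isZmodule.Build freeLie fl_addA fl_addC fl_add0 fl_addN.

Fact fl_scaleA c d a : fl_scale c (fl_scale d a) = fl_scale (c * d) a.
Proof.
elim/quotW: a => t; rewrite -!fl_piE; apply/fl_eqP; exact: lc_scaleA.
Qed.
Fact fl_scale1 : left_id 1 fl_scale.
Proof.
elim/quotW => t; rewrite -!fl_piE; apply/fl_eqP; exact: lc_scale1.
Qed.
Fact fl_scaleDr : right_distributive fl_scale +%R.
Proof.
move=> c; elim/quotW => t; elim/quotW => u.
rewrite /GRing.add /= -!fl_piE; apply/fl_eqP; exact: lc_scaleDr.
Qed.
Fact fl_scaleDl a : {morph fl_scale^~ a : c d / c + d}.
Proof.
move=> c d; elim/quotW: a => t; rewrite /GRing.add /= -!fl_piE.
apply/fl_eqP; exact: lc_scaleDl.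
Qed.
HB.instance Definition _ := GRing.Zmodule_isLmodule.Build K freeLie
  fl_scaleA fl_scale1 fl_scaleDr fl_scaleDl.

Lemma pi_add t u : \pi_freeLie (LAdd t u) = \pi_freeLie t + \pi_freeLie u.
Proof. exact: fl_piD. Qed.
Lemma pi_scale c t : \pi_freeLie (LScale c t) = c *: \pi_freeLie t.
Proof. exact: fl_piZ. Qed.

Fact fl_liePl (c : K) a b z :
  fl_lie (c *: a + b) z = c *: fl_lie a z + fl_lie b z.
Proof.
elim/quotW: a => t; elim/quotW: b => u; elim/quotW: z => v.
by have /fl_eqP := lc_brl c t u v; rewrite !(pi_add, pi_scale, fl_piL).
Qed.
Fact fl_liePr (c : K) z a b :
  fl_lie z (c *: a + b) = c *: fl_lie z a + fl_lie z b.
Proof.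
elim/quotW: a => t; elim/quotW: b => u; elim/quotW: z => v.
by have /fl_eqP := lc_brr c t u v; rewrite !(pi_add, pi_scale, fl_piL).
Qed.
Fact fl_liexx a : fl_lie a a = 0.
Proof. elim/quotW: a => t; rewrite -!fl_piE; apply/fl_eqP; exact: lc_alt. Qed.
Fact fl_lie_jacobi a b c :
  fl_lie (fl_lie a b) c + fl_lie (fl_lie b c) a + fl_lie (fl_lie c a) b = 0.
Proof.
elim/quotW: a => t; elim/quotW: b => u; elim/quotW: c => v.
by have /fl_eqP := lc_jacobi t u v; rewrite !(pi_add, fl_piL).
Qed.
HB.instance Definition _ :=
  isLieAlgebra.Build K freeLie fl_liePl fl_liePr fl_liexx fl_lie_jacobi.

Lemma pi_lie t u :
  \pi_freeLie (LBr t u) = lie (\pi_freeLie t) (\pi_freeLie u).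
Proof. exact: fl_piL. Qed.

Section Lift.
Variables (L : lieAlgType K) (f : X -> L).

Fixpoint leval (t : lterm) : L :=
  match t with
  | LVar x => f x
  | LZero => 0
  | LAdd t u => leval t + leval u
  | LScale c t => c *: leval t
  | LBr t u => lie (leval t) (leval u)
  end.

Lemma leval_cong t u : lcong t u -> leval t = leval u.
Proof.
elim=> //=.
- by move=> ? ? ? _ -> _ ->.
- by move=> ? ? ? ? _ -> _ ->.
- by move=> ? ? ? _ ->.
- by move=> ? ? ? ? _ -> _ ->.
- by move=> ? ? ?; rewrite addrA.
- by move=> ? ?; rewrite addrC.
- by move=> ?; rewrite add0r.
- by move=> ?; rewrite scaleN1r addNr.
- by move=> ? ? ?; rewrite scalerA.
- by move=> ?; rewrite scale1r.
- by move=> ? ? ?; rewrite scalerDr.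
- by move=> ? ? ?; rewrite scalerDl.
- by move=> ? ? ? ?; rewrite liePl.
- by move=> ? ? ? ?; rewrite liePr.
- by move=> ?; rewrite liexx.
- by move=> ? ? ?; rewrite lie_jacobi.
Qed.

Definition fl_lift (a : freeLie) : L := leval (repr a).

Lemma fl_liftE t : fl_lift (\pi_freeLie t) = leval t.
Proof. exact/leval_cong/lcong_repr. Qed.

(* Universal property of the free Lie algebra on X. *)
Lemma fl_lift_var x : fl_lift (fl_var x) = f x.
Proof. by rewrite fl_liftE. Qed.

Lemma fl_lift_hom : lie_hom fl_lift.
Proof.
split=> [c|]; elim/quotW => t; elim/quotW => u.
  by rewrite -(pi_scale c t) -(pi_add (LScale c t) u) !fl_liftE.
by rewrite -(pi_lie t u) !fl_liftE.
Qed.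

Lemma fl_lift_unique (phi : freeLie -> L) :
  lie_hom phi -> (forall x, phi (fl_var x) = f x) -> phi =1 fl_lift.
Proof.
move=> [phiP phiL] phif; elim/quotW => t; rewrite fl_liftE.
have phi0 : phi 0 = 0.
  by have := phiP (-1) 0 0; rewrite scaleN1r oppr0 addr0 scaleN1r addNr.
elim: t => [x||t IHt u IHu|c t IHt|t IHt u IHu] //=.
- exact: phif.
- rewrite pi_add -IHt -IHu -[in RHS](scale1r (phi _)) -phiP.
  by rewrite scale1r.
- by rewrite pi_scale -IHt -[RHS]addr0 -phi0 -phiP addr0.
- by rewrite pi_lie -IHt -IHu -phiL.
Qed.

End Lift.
End FreeLie.

Section Identities.
Variable K : fieldType.

(* Id(UT_n^(-)), in variables indexed by nat *)
Definition Id_UT (n : nat) : set (freeLie K nat) :=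
  [set f | forall phi : freeLie K nat -> ut K n, lie_hom phi -> phi f = 0].

Variable G : groupType.

(* Indices start at 0: the variable written x_{i,l} with i = 1, 2, ... is
   xvar i.-1 l. *)
Local Notation LXG := (freeLie K (nat * G)%type).
Definition xvar (i : nat) (l : G) : LXG := fl_var K (i, l).
Definition yvar (i : nat) : LXG := xvar i 1%g.

Inductive fl_deg : G -> set LXG :=
| fl_deg_var i l : fl_deg l (xvar i l)
| fl_deg0 l : fl_deg l 0
| fl_degP l (c : K) a b : fl_deg l a -> fl_deg l b -> fl_deg l (c *: a + b)
| fl_deg_lie l m a b : fl_deg l a -> fl_deg m b -> fl_deg (l * m)%g (lie a b).

Definition graded_hom (L1 L2 : lieAlgType K)
    (D1 : G -> set L1) (D2 : G -> set L2) (phi : L1 -> L2) : Prop :=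
  lie_hom phi /\ (forall l a, D1 l a -> D2 l (phi a)).

Definition TG_ideal (I : set LXG) : Prop :=
  lie_ideal I /\
  (forall phi : LXG -> LXG, graded_hom fl_deg fl_deg phi ->
     forall a, I a -> I (phi a)).

Definition TG_gen (S : set LXG) : set LXG :=
  [set f | forall I, TG_ideal I -> S `<=` I -> I f].

Definition Id_G (n : nat) (D : G -> set (ut K n)) : set LXG :=
  [set f | forall phi : LXG -> ut K n, graded_hom fl_deg D phi -> phi f = 0].

(* The inclusion of L(Y) into L(X^G). *)
Definition Yincl : freeLie K nat -> LXG := fl_lift yvar.

(* [u, y_1^(p_1), ..., y_r^(p_r)], where p_{i+1} is p i *)
Definition lcomm_y (u : LXG) (r : nat) (p : nat -> nat) : LXG :=
  foldl (fun v i => lie_pow v (yvar i) (p i)) u (iota 0 r).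

(* Degree of the matrix unit e_ij (i <= j) in Gamma(g, h); the value for
   i > j is irrelevant. *)
Definition Gamma_deg (g h : G) (i j : 'I_3) : G :=
  match val i, val j with
  | 0%N, 1%N => g
  | 1%N, 2%N => h
  | 0%N, 2%N => (g * h)%g
  | _, _ => 1%g
  end.

(* The component of degree l: the span of the e_ij of degree l *)
Definition Gamma (g h : G) (l : G) : set (ut K 3) :=
  [set A | forall i j, ut_val A i j != 0 -> Gamma_deg g h i j = l].

Definition Supp (n : nat) (D : G -> set (ut K n)) : set G :=
  [set l | exists2 A, D l A & A != 0].

(* p < |K|; no condition if K is infinite *)
Definition lt_card (p : nat) : Prop :=
  forall q, [set: K] #= `I_q -> (p < q)%N.

(* x_l is represented by x_{1,l} and y by y_1. *)
Definition generators (g : G) : set LXG :=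
  [set f | exists2 l, ~ Supp (Gamma g g^-1%g) l & f = xvar 0 l] `|`
  [set f | exists2 l, l \in [:: g; g^-1%g] & f = lie (xvar 0 l) (xvar 1 l)] `|`
  [set f | exists l h, [/\ l \in [:: g; g^-1%g], h \in [:: g; g^-1%g], l != h
                        & f = lie (lie (xvar 0 l) (xvar 0 h)) (xvar 1 l)]] `|`
  [set f | exists2 l, l \in [:: g; g^-1%g]
                   & f = lie (lie (yvar 0) (yvar 1)) (xvar 0 l)] `|`
  Yincl @` Id_UT 2 `|`
  [set f | exists l q, [/\ l \in [:: g; g^-1%g], [set: K] #= `I_q
           & f = lie_pow (xvar 0 l) (yvar 0) q - lie (xvar 0 l) (yvar 0)]].

Definition basis_x (g : G) : set LXG :=
  [set f | exists l i r p, [/\ l \in [:: g; g^-1%g],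
             (forall k, (k < r)%N -> lt_card (p k))
           & f = lcomm_y (xvar i l) r p]].

Definition basis_xx (g : G) : set LXG :=
  [set f | exists i j r p q,
     (forall k, (k < r)%N -> lt_card (p k) /\ lt_card (q k)) /\
     f = lie (lcomm_y (xvar i g) r p) (lcomm_y (xvar j g^-1%g) r q)].

End Identities.

Arguments Id_UT K n _ : clear implicits.
Arguments Yincl K G _ : clear implicits.
Arguments Gamma K {G} g h l.
Arguments generators K {G} g.
Arguments basis_x K {G} g.
Arguments basis_xx K {G} g.

(* Main.v *)
Require Import Defs.
From HB Require Import structures.
From mathcomp Require Import all_boot all_order all_algebra generic_quotient ring.
From mathcomp Require Import boolp classical_sets functions cardinality.

(* Write A_l for the span of the [x_l, y_1^(p_1), ..., y_r^(p_r)].  Modulo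
   (i)-(iv) and (vi), A_l is stable under bracketing with L(Y): by (iv) the y's
   commute when acting on x_l, and by (vi) exponents can be reduced below |K|.
   Together with (ii) and (iii) this makes
   L(Y) + A_g + A_{g^-1} + [A_g, A_{g^-1}] an ideal containing all variables
   of degree in the support, hence everything.

   Conversely, the neutral component of the grading is UT_2 x K, spanned by
   e_11, e_33, e_13 and e_22, so a polynomial in Y is an identity iff it is one
   of UT_2.  The evaluations x_{i,g} -> e_12, x_{j,g^-1} -> e_23,
   y_k -> diag(-a_k, 0, b_k) turn the other normal forms into the reduced
   monomials in the a_k and b_k, which are linearly independent functions on
   tuples of elements of K. *)

Set Implicit Arguments.
Unset Strict Implicit.
Unset Printing Implicit Defensive.

Import GRing.Theory.
Local Open Scope ring_scope.
Local Open Scope classical_set_scope.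
Local Open Scope card_scope.

(** * Elementary identities in a Lie algebra *)

Section LieBasics.
Variables (K : fieldType) (L : lieAlgType K).
Implicit Types (a b c : L) (k : K).

Lemma lieDl a b c : lie (a + b) c = lie a c + lie b c.
Proof. by have := liePl 1 a b c; rewrite !scale1r. Qed.

Lemma lieDr a b c : lie c (a + b) = lie c a + lie c b.
Proof. by have := liePr 1 c a b; rewrite !scale1r. Qed.

Lemma lie0l c : lie 0 c = 0 :> L.
Proof. by apply: (addIr (lie 0 c)); rewrite -lieDl !add0r. Qed.

Lemma lie0r c : lie c 0 = 0 :> L.
Proof. by apply: (addIr (lie c 0)); rewrite -lieDr !add0r. Qed.

Lemma lieZl k a c : lie (k *: a) c = k *: lie a c.
Proof. by have := liePl k a 0 c; rewrite lie0l !addr0. Qed.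

Lemma lieZr k a c : lie c (k *: a) = k *: lie c a.
Proof. by have := liePr k c a 0; rewrite lie0r !addr0. Qed.

Lemma lieNl a c : lie (- a) c = - lie a c.
Proof. by rewrite -scaleN1r lieZl scaleN1r. Qed.

Lemma lieBl a b c : lie (a - b) c = lie a c - lie b c.
Proof. by rewrite lieDl lieNl. Qed.

Lemma lieC a b : lie a b = - lie b a.
Proof.
apply/eqP; rewrite -addr_eq0; apply/eqP.
have := liexx (a + b).
by rewrite lieDl !lieDr !liexx add0r addr0.
Qed.

(** The Jacobi identity rearranged by anticommutativity: right bracketing with [c] is a
    derivation. *)
Lemma lie_derl a b c : lie (lie a b) c = lie (lie a c) b + lie a (lie b c).
Proof.
have := lie_jacobi a b c; rewrite [lie (lie b c) a]lieC [lie c a]lieC lieNl.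
by move/eqP; rewrite -addrA -opprD subr_eq0 addrC => /eqP.
Qed.

Lemma lie_derr a b c : lie a (lie b c) = lie (lie a b) c - lie (lie a c) b.
Proof. by rewrite lie_derl addrAC subrr add0r. Qed.

End LieBasics.

(** * Lie homomorphisms *)

Section LieHom.
Variables (K : fieldType) (L1 L2 L3 : lieAlgType K).

Lemma lie_hom_br (phi : L1 -> L2) a b :
  lie_hom phi -> phi (lie a b) = lie (phi a) (phi b).
Proof. by case=> _ ->. Qed.

Lemma lie_hom0 (phi : L1 -> L2) : lie_hom phi -> phi 0 = 0.
Proof.
by case=> lin _; have := lin (-1) 0 0; rewrite scaleN1r oppr0 addr0 scaleN1r addNr.
Qed.

Lemma lie_homZ (phi : L1 -> L2) c a : lie_hom phi -> phi (c *: a) = c *: phi a.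
Proof.
by move=> h; have := h.1 c a 0; rewrite (lie_hom0 h) !addr0.
Qed.

Lemma lie_homD (phi : L1 -> L2) a b : lie_hom phi -> phi (a + b) = phi a + phi b.
Proof. by case=> lin _; have := lin 1 a b; rewrite !scale1r. Qed.

Lemma lie_homB (phi : L1 -> L2) a b : lie_hom phi -> phi (a - b) = phi a - phi b.
Proof. by move=> h; rewrite lie_homD // -scaleN1r lie_homZ // scaleN1r. Qed.

Lemma lie_hom_sum (phi : L1 -> L2) (s : seq L1) (c : L1 -> K) :
  lie_hom phi -> phi (\sum_(b <- s) c b *: b) = \sum_(b <- s) c b *: phi b.
Proof.
move=> h; elim: s => [|b s IH]; first by rewrite !big_nil lie_hom0.
by rewrite !big_cons lie_homD // lie_homZ // IH.
Qed.

Lemma lie_hom_pow (phi : L1 -> L2) a b m :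
  lie_hom phi -> phi (lie_pow a b m) = lie_pow (phi a) (phi b) m.
Proof. by move=> h; elim: m => //= m <-; rewrite lie_hom_br. Qed.

Lemma lie_hom_comp (phi : L1 -> L2) (psi : L2 -> L3) :
  lie_hom phi -> lie_hom psi -> lie_hom (psi \o phi).
Proof.
move=> [l1 b1] [l2 b2]; split=> [c a b|a b] /=; first by rewrite l1 l2.
by rewrite b1 b2.
Qed.

End LieHom.

(** * Congruences modulo a Lie ideal *)

Section LieIdeal.
Variables (K : fieldType) (L : lieAlgType K) (I : set L).
Hypothesis idI : lie_ideal I.

Lemma ideal0 : I 0. Proof. by case: idI. Qed.

Lemma idealZ c a : I a -> I (c *: a).
Proof. by case: idI => I0 IP _ Ia; rewrite -[_ *: _]addr0; apply: IP. Qed.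

Lemma idealD a b : I a -> I b -> I (a + b).
Proof. by case: idI => _ IP _ Ia Ib; rewrite -[a]scale1r; apply: IP. Qed.

Lemma idealN a : I a -> I (- a).
Proof. by rewrite -scaleN1r; apply: idealZ. Qed.

Lemma idealB a b : I a -> I b -> I (a - b).
Proof. by move=> Ia Ib; apply/idealD/idealN. Qed.

Lemma ideal_liel a b : I a -> I (lie a b).
Proof. by case: idI => _ _; apply. Qed.

Lemma ideal_lier a b : I a -> I (lie b a).
Proof. by move=> Ia; rewrite lieC; apply/idealN/ideal_liel. Qed.

Lemma ideal_trans b a c : I (a - b) -> I (b - c) -> I (a - c).
Proof. by move=> ab bc; rewrite -(subrKA b); apply: idealD. Qed.

Lemma ideal_congl a b c : I (a - b) -> I (lie a c - lie b c).
Proof. by move=> ab; rewrite -lieBl; apply: ideal_liel. Qed.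

Lemma ideal_pow_congl a b c m : I (a - b) -> I (lie_pow a c m - lie_pow b c m).
Proof. by move=> ab; elim: m => //= m; apply: ideal_congl. Qed.

End LieIdeal.

(** * Linear spans and induction in the free Lie algebra *)

Section Span.
Variables (K : fieldType) (L : lmodType K).

(** Combinations are built one term at a time, with repetitions allowed, so that linear arguments
    become inductions; [lspan_uniq] recovers a sum over distinct vectors. *)
Inductive lspan (S : set L) : set L :=
| lspan_0 : lspan S 0
| lspan_cons c b f : S b -> lspan S f -> lspan S (c *: b + f).

Variable S : set L.

Lemma lspan_in b : S b -> lspan S b.
Proof. by move=> Sb; rewrite -[b]addr0 -[b in b + _]scale1r; do !constructor. Qed.

Lemma lspanD f h : lspan S f -> lspan S h -> lspan S (f + h).
Proof.
move=> Sf Sh; elim: Sf => [|c b {}f Sb _ IH]; first by rewrite add0r.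
by rewrite -addrA; constructor.
Qed.

Lemma lspanZ c f : lspan S f -> lspan S (c *: f).
Proof.
elim=> [|d b {}f Sb _ IH]; first by rewrite scaler0; constructor.
by rewrite scalerDr scalerA; constructor.
Qed.

Lemma lspanN f : lspan S f -> lspan S (- f).
Proof. by rewrite -scaleN1r; apply: lspanZ. Qed.

Lemma lspan_sum (s : seq L) (c : L -> K) :
  (forall b, b \in s -> S b) -> lspan S (\sum_(b <- s) c b *: b).
Proof.
elim: s => [|b s IH] hs; first by rewrite big_nil; constructor.
rewrite big_cons; constructor; first by apply: hs; rewrite inE eqxx.
by apply: IH => d ds; apply: hs; rewrite inE ds orbT.
Qed.

Lemma lspan_uniq f : lspan S f ->
  exists (s : seq L) (c : L -> K),
    [/\ uniq s, forall b, b \in s -> S b & f = \sum_(b <- s) c b *: b].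
Proof.
elim=> [|d b {}f Sb _ [s [c [us hs ->]]]].
  by exists [::], (fun=> 0); split=> //; rewrite big_nil.
(* If [b] already occurs in [s], its old coefficient is increased by [d]; otherwise [b] is a new
   term with coefficient [d]. *)
pose c' x := if x == b then d + (if b \in s then c b else 0) else c x.
have c'E t : b \notin t -> \sum_(x <- t) c' x *: x = \sum_(x <- t) c x *: x.
  move=> bt; apply: eq_big_seq => x xt; rewrite /c'.
  by case: eqP xt => // ->; rewrite (negbTE bt).
have [bs|bs] := boolP (b \in s).
  exists s, c'; split=> //.
  rewrite !(perm_big _ (perm_to_rem bs)) /= !big_cons c'E; last first.
    by rewrite mem_rem_uniqF.
  by rewrite /c' eqxx bs scalerDl addrA.
exists (b :: s), c'; split=> /=; first by rewrite bs.
  by move=> x; rewrite inE => /orP[/eqP ->|/hs].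
by rewrite big_cons c'E // /c' eqxx (negbTE bs) addr0.
Qed.

End Span.

Lemma lspan_sub (K : fieldType) (L : lmodType K) (S T : set L) f :
  (forall b, S b -> lspan T b) -> lspan S f -> lspan T f.
Proof.
move=> h; elim=> [|c b {}f Sb _ IH]; first by constructor.
by apply: lspanD => //; apply/lspanZ/h.
Qed.

Lemma lspan_lie (K : fieldType) (L : lieAlgType K) (S T : set L) v f :
  (forall b, S b -> lspan T (lie b v)) -> lspan S f -> lspan T (lie f v).
Proof.
move=> h; elim=> [|c b {}f Sb _ IH]; first by rewrite lie0l; constructor.
by rewrite lieDl lieZl; apply: lspanD => //; apply/lspanZ/h.
Qed.

(** Induction on a representing term: sums and scalar multiples are both special cases of the clause
    for [c *: a + b]. *)
Lemma freeLie_ind (K : fieldType) (X : Type) (P : freeLie K X -> Prop) :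
    (forall x, P (fl_var K x)) -> P 0 ->
    (forall c a b, P a -> P b -> P (c *: a + b)) ->
    (forall a b, P a -> P b -> P (lie a b)) ->
  forall f, P f.
Proof.
move=> Pv P0 PP Pl; elim/quotW.
elim=> [x||t IHt u IHu|c t IHt|t IHt u IHu].
- exact: Pv.
- exact: P0.
- by rewrite Defs.pi_add -[X in X + _]scale1r; apply: PP.
- by rewrite Defs.pi_scale -[_ *: _]addr0; apply: PP.
- by rewrite pi_lie; apply: Pl.
Qed.

(** * Graded substitutions, generated T_G-ideals and the commutators [lcomm_y] *)

Section Graded.
Variables (K : fieldType) (G : groupType).
Local Notation LXG := (freeLie K (nat * G)%type).

(** Homogeneous elements are generated inductively from the variables, so once [D] is closed under
    the same operations, only the values on variables need checking. *)
Lemma graded_lift (L : lieAlgType K) (D : G -> set L) (f : nat * G -> L) :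
    (forall l, D l 0) ->
    (forall l c a b, D l a -> D l b -> D l (c *: a + b)) ->
    (forall l m a b, D l a -> D m b -> D (l * m)%g (lie a b)) ->
    (forall i l, D l (f (i, l))) ->
  graded_hom (fl_deg (G := G)) D (fl_lift f).
Proof.
move=> D0 DP Dl Df; split; first exact: fl_lift_hom.
have hom := fl_lift_hom f.
move=> l a; elim=> {l a} [i l|l|l c a b _ Da _ Db|l m a b _ Da _ Db].
- by rewrite fl_lift_var.
- by rewrite lie_hom0.
- by rewrite lie_homD // lie_homZ //; apply: DP.
- by rewrite lie_hom_br //; apply: Dl.
Qed.

Lemma graded_hom_comp (L : lieAlgType K) (D : G -> set L)
    (phi : LXG -> LXG) (psi : LXG -> L) :
    graded_hom (fl_deg (G := G)) (fl_deg (G := G)) phi ->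
    graded_hom (fl_deg (G := G)) D psi ->
  graded_hom (fl_deg (G := G)) D (psi \o phi).
Proof.
move=> [h1 g1] [h2 g2]; split; first exact: lie_hom_comp.
by move=> l a /g1 /g2.
Qed.

(** Generators (i)-(iv) and (vi) involve at most three variables, so three prescribed values
    instantiate any of them. Surplus slots can receive 0, which is homogeneous of every degree. *)
Lemma graded_subst (k1 k2 k3 : nat * G) (a1 a2 a3 : LXG) :
    k1 != k2 -> k1 != k3 -> k2 != k3 ->
    fl_deg k1.2 a1 -> fl_deg k2.2 a2 -> fl_deg k3.2 a3 ->
  exists phi : LXG -> LXG,
    [/\ graded_hom (fl_deg (G := G)) (fl_deg (G := G)) phi,
        phi (fl_var K k1) = a1, phi (fl_var K k2) = a2
      & phi (fl_var K k3) = a3].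
Proof.
move=> n12 n13 n23 d1 d2 d3.
pose f v : LXG := if v == k1 then a1 else if v == k2 then a2
                  else if v == k3 then a3 else fl_var K v.
exists (fl_lift f); split; rewrite ?fl_lift_var /f ?eqxx //.
- apply: graded_lift => [l|l c a b|l m a b|i l].
  + exact: fl_deg0.
  + exact: fl_degP.
  + exact: fl_deg_lie.
  rewrite /f; case: eqP => [e|_]; first by rewrite -e in d1.
  case: eqP => [e|_]; first by rewrite -e in d2.
  by case: eqP => [e|_]; [rewrite -e in d3|exact: fl_deg_var].
- by rewrite eq_sym (negbTE n12).
- by rewrite eq_sym (negbTE n13) eq_sym (negbTE n23).
Qed.

Lemma TG_ideal_gen (S : set LXG) : TG_ideal (TG_gen S).
Proof.
split; first split.
- by move=> I [idI _] _; apply: ideal0.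
- move=> c a b Ia Ib I IT SI; case: (IT) => -[_ IP _] _.
  by apply: IP; [apply: Ia|apply: Ib].
- by move=> a b Ia I IT SI; apply: ideal_liel; [case: IT|apply: Ia].
- by move=> phi gphi a Ia I IT SI; case: (IT) => _; apply; [|apply: Ia].
Qed.

Lemma sub_TG_gen (S : set LXG) : S `<=` TG_gen S.
Proof. by move=> f Sf I _; apply. Qed.

Lemma lcomm_yS (u : LXG) r p :
  lcomm_y u r.+1 p = lie_pow (lcomm_y u r p) (yvar K G r) (p r).
Proof. by rewrite /lcomm_y -addn1 iotaD add0n foldl_cat. Qed.

Lemma eq_lcomm_y (u : LXG) r p q :
  (forall k, (k < r)%N -> p k = q k) -> lcomm_y u r p = lcomm_y u r q.
Proof.
elim: r => // r IH pq; rewrite !lcomm_yS pq // IH // => k kr.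
by apply: pq; rewrite ltnS ltnW.
Qed.

(** Padding with zero exponents changes nothing; this brings commutators of different lengths to a
    common number of [y]'s. *)
Lemma lcomm_y_widen (u : LXG) r N p : (r <= N)%N ->
  lcomm_y u r p = lcomm_y u N (fun k => if (k < r)%N then p k else 0%N).
Proof.
move=> /subnKC <-; elim: (N - r)%N => [|n IH].
  by rewrite addn0; apply: eq_lcomm_y => k ->.
by rewrite addnS lcomm_yS -IH ltnNge leq_addr.
Qed.

Lemma fl_deg_pow l (a : LXG) i m : fl_deg l a -> fl_deg l (lie_pow a (yvar K G i) m).
Proof.
move=> da; elim: m => //= m IH; rewrite -[l]mulg1.
by apply: fl_deg_lie => //; apply: fl_deg_var.
Qed.

Lemma fl_deg_lcomm_y l (a : LXG) r p : fl_deg l a -> fl_deg l (lcomm_y a r p).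
Proof. by move=> da; elim: r => // r IH; rewrite lcomm_yS; apply: fl_deg_pow. Qed.

Lemma lie_hom_lcomm_y0 (L : lieAlgType K) (phi : LXG -> L) u r p :
  lie_hom phi -> phi u = 0 -> phi (lcomm_y u r p) = 0.
Proof.
move=> h u0; elim: r => // r IH; rewrite lcomm_yS lie_hom_pow // IH.
by elim: (p r) => //= m ->; rewrite lie0l.
Qed.

Lemma Yincl_hom : lie_hom (Yincl K G). Proof. exact: fl_lift_hom. Qed.

Lemma Yincl_var i : Yincl K G (fl_var K i) = yvar K G i.
Proof. exact: fl_lift_var. Qed.

End Graded.

(** * Exponents below the cardinality of the field *)

Lemma lt_card0 (K : fieldType) : lt_card K 0.
Proof.
move=> [|q] //; rewrite II0 card_eq0 => /eqP h.
by have : [set: K] 0 by []; rewrite h.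
Qed.

Lemma lt_card1 (K : fieldType) : lt_card K 1.
Proof.
move=> q /card_set_bijP[f [ffun finj _]]; rewrite ltnNge; apply/negP => q1.
have f0 x : f x = 0%N.
  by move: (ffun x I) => /=; case: (q) q1 => [|[]] // _; case: (f x).
have /eqP := oner_neq0 K; apply; apply: finj; rewrite ?inE //.
by rewrite !f0.
Qed.

(** The dichotomy behind exponent reduction: a raised exponent is either still admissible or exactly
    the order of [K], where (vi) applies. *)
Lemma lt_cardS (K : fieldType) p : lt_card K p ->
  lt_card K p.+1 \/ [set: K] #= `I_p.+1.
Proof.
move=> hp; have [h|h] := pselect (lt_card K p.+1); [by left|right].
have /existsNP[q /not_implyP[Kq /negP]] := h.
rewrite -leqNgt => qp; have pq := hp _ Kq.
by have <- : q = p.+1 by apply/eqP; rewrite eqn_leq qp.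
Qed.

(** * Reduction to normal form modulo the generators *)

Section Relations.
Variables (K : fieldType) (G : groupType) (g : G).
Hypothesis g2_neq1 : (g ^+ 2)%g <> 1%g.
Local Notation LXG := (freeLie K (nat * G)%type).
Local Notation deg := (@fl_deg K G).
Local Notation y := (yvar K G).

Lemma g_neq1 : g != 1%g.
Proof. by apply/eqP => g1; apply: g2_neq1; rewrite g1 expg1n. Qed.

Lemma gV_neq1 : g^-1%g != 1%g.
Proof. by rewrite invg_eq1 g_neq1. Qed.

Lemma g_neqV : g != g^-1%g.
Proof.
by apply/eqP => gV; apply: g2_neq1; rewrite expgS expg1 {2}gV mulgV.
Qed.

Lemma neq1_supp l : l \in [:: g; g^-1%g] -> l != 1%g.
Proof. by rewrite !inE => /orP[]/eqP ->; rewrite (g_neq1, gV_neq1). Qed.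

(** Since [e_13] has degree [g * g^-1 = 1], every matrix unit has degree 1, [g] or [g^-1]. *)
Lemma notin_Supp l :
  l != 1%g -> l \notin [:: g; g^-1%g] -> ~ Supp (Gamma K g g^-1%g) l.
Proof.
move=> l1 lg [A hA /eqP]; apply; apply: val_inj; apply/matrixP => i j /=.
rewrite [RHS]mxE; apply/eqP/contraT => /hA; rewrite /Gamma_deg mulgV => e.
case/negP: lg; rewrite !inE -e.
move: e l1; case: (val i) => [|[|n]]; case: (val j) => [|[|[|m]]] <-;
  by rewrite ?eqxx ?orbT.
Qed.

Variable I : set LXG.
Hypotheses (TGI : TG_ideal I) (gensI : generators K g `<=` I).
Let idI : lie_ideal I := TGI.1.

(** A T_G-ideal is stable under graded substitutions, so a generator stated for variables holds for
    all homogeneous elements of the same degrees. The lemmas up to [rel_q] carry this out for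
    (i)-(iv) and (vi). *)
Lemma rel_supp l a : l != 1%g -> l \notin [:: g; g^-1%g] -> deg l a -> I a.
Proof.
move=> l1 lg da.
have [phi [gphi <- _ _]] :=
  @graded_subst K G (0%N, l) (1%N, l) (2%N, l) a 0 0 isT isT isT da
    (fl_deg0 _ _) (fl_deg0 _ _).
apply: TGI.2 => //; apply: gensI; do 5!left; exists l => //.
exact: notin_Supp.
Qed.

Lemma rel_same l a b : l \in [:: g; g^-1%g] -> deg l a -> deg l b -> I (lie a b).
Proof.
move=> lg da db.
have [phi [gphi <- <- _]] :=
  @graded_subst K G (0%N, l) (1%N, l) (2%N, l) a b 0 isT isT isT da db
    (fl_deg0 _ _).
rewrite -(lie_hom_br _ _ gphi.1).
by apply: TGI.2 => //; apply: gensI; do 4!left; right; exists l.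
Qed.

Lemma rel_lhl l h a b c : l \in [:: g; g^-1%g] -> h \in [:: g; g^-1%g] ->
  l != h -> deg l a -> deg h b -> deg l c -> I (lie (lie a b) c).
Proof.
move=> lg hg lh da db dc.
have [||phi [gphi <- <- <-]] :=
  @graded_subst K G (0%N, l) (0%N, h) (1%N, l) a b c _ isT _ da db dc.
- by rewrite xpair_eqE eqxx.
- by rewrite xpair_eqE.
rewrite -!(lie_hom_br _ _ gphi.1).
by apply: TGI.2 => //; apply: gensI; do 3!left; right; exists l, h.
Qed.

Lemma rel_yyx l a b c : l \in [:: g; g^-1%g] ->
  deg 1%g a -> deg 1%g b -> deg l c -> I (lie (lie a b) c).
Proof.
move=> lg da db dc; have l1 := neq1_supp lg.
have [||phi [gphi <- <- <-]] :=
  @graded_subst K G (0%N, 1%g) (1%N, 1%g) (0%N, l) a b c isT _ _ da db dc.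
- by rewrite xpair_eqE eq_sym (negbTE l1).
- by rewrite xpair_eqE.
rewrite -!(lie_hom_br _ _ gphi.1).
by apply: TGI.2 => //; apply: gensI; do 2!left; right; exists l.
Qed.

Lemma rel_q l q a b : l \in [:: g; g^-1%g] -> [set: K] #= `I_q ->
  deg l a -> deg 1%g b -> I (lie_pow a b q - lie a b).
Proof.
move=> lg Kq da db; have l1 := neq1_supp lg.
have [|phi [gphi <- <- _]] :=
  @graded_subst K G (0%N, l) (0%N, 1%g) (1%N, l) a b 0 _ isT isT da db
    (fl_deg0 _ _).
- by rewrite xpair_eqE.
rewrite -(lie_hom_br _ _ gphi.1) -(lie_hom_pow _ _ _ gphi.1).
rewrite -(lie_homB _ _ gphi.1).
by apply: TGI.2 => //; apply: gensI; right; exists l, q.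
Qed.

(** Moving [y k] past one [y i] costs a bracket of some [u] of degree [l] with [[y i, y k]], which
    lies in [I] by (iv). *)
Lemma pow_y_swap l a i k m : l \in [:: g; g^-1%g] -> deg l a ->
  I (lie (lie_pow a (y i) m) (y k) - lie_pow (lie a (y k)) (y i) m).
Proof.
move=> lg da; elim: m => [|m IH] /=; first by rewrite subrr; apply: ideal0.
apply: (ideal_trans idI) (ideal_congl idI _ IH).
rewrite lie_derl addrAC subrr add0r lieC; apply: (idealN idI).
by apply: (rel_yyx lg); do ?exact: fl_deg_var; apply: fl_deg_pow.
Qed.

Lemma lcomm_y_mul l u N p k : l \in [:: g; g^-1%g] -> deg l u -> (k < N)%N ->
  I (lie (lcomm_y u N p) (y k)
     - lcomm_y u N (fun j => if j == k then (p j).+1 else p j)).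
Proof.
move=> lg du; elim: N => // N IH; rewrite ltnS leq_eqVlt => /orP[/eqP ->|kN].
  rewrite !lcomm_yS eqxx /=.
  rewrite -(@eq_lcomm_y _ _ u N p) ?subrr; first exact: ideal0.
  by move=> j jN; rewrite ltn_eqF.
rewrite !lcomm_yS (gtn_eqF kN).
apply: (ideal_trans idI) (ideal_pow_congl idI _ _ (IH kN)).
by apply: pow_y_swap lg _; apply: fl_deg_lcomm_y.
Qed.

(** When [y k] is the last variable this is (vi) applied to the shorter commutator; later variables
    merely transport the congruence. *)
Lemma lcomm_y_reduce l u N p k q : l \in [:: g; g^-1%g] -> deg l u ->
    [set: K] #= `I_q -> p k = q -> (k < N)%N ->
  I (lcomm_y u N p - lcomm_y u N (fun j => if j == k then 1%N else p j)).
Proof.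
move=> lg du Kq pk; elim: N => // N IH.
rewrite ltnS leq_eqVlt !lcomm_yS => /orP[/eqP kN|kN].
  rewrite -kN eqxx pk.
  rewrite -(@eq_lcomm_y _ _ u k p) => [|j jk]; last by rewrite ltn_eqF.
  apply: rel_q lg Kq _ _; first exact: fl_deg_lcomm_y.
  exact: fl_deg_var.
by rewrite (gtn_eqF kN); apply: ideal_pow_congl => //; apply: IH.
Qed.

Definition basis_xl l : set LXG :=
  [set f | exists i r p, (forall k, (k < r)%N -> lt_card K (p k)) /\
                         f = lcomm_y (xvar K i l) r p].

Lemma lt_card_widen r (p : nat -> nat) : (forall k, (k < r)%N -> lt_card K (p k)) ->
  forall k, lt_card K (if (k < r)%N then p k else 0%N).
Proof. by move=> hp k; case: ifP => [/hp //|_]; apply: lt_card0. Qed.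

Lemma basis_xl_y l f k : l \in [:: g; g^-1%g] -> basis_xl l f ->
  lspan (I `|` basis_xl l) (lie f (y k)).
Proof.
move=> lg [i [r [p [hp ->]]]].
(* The commutator is lengthened so that [y k] is among its variables, with exponent 0 if it was
   absent. *)
pose N := maxn r k.+1.
have dx : deg l (xvar K i l) by exact: fl_deg_var.
rewrite (@lcomm_y_widen _ _ _ r N) ?leq_maxl //.
set p1 := fun j => if (j < r)%N then p j else 0%N.
have hp1 j : lt_card K (p1 j) by apply: lt_card_widen hp j.
move: {hp} p1 hp1 => {}p hp.
have kN : (k < N)%N by rewrite leq_maxr.
set p' := fun j => if j == k then (p j).+1 else p j.
suff [p2 [hp2 I2]] : exists p2, (forall j, lt_card K (p2 j)) /\
    I (lie (lcomm_y (xvar K i l) N p) (y k) - lcomm_y (xvar K i l) N p2).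
  rewrite -[lie _ _](subrK (lcomm_y (xvar K i l) N p2)).
  apply: lspanD; first by apply: lspan_in; left.
  by apply: lspan_in; right; exists i, N, p2.
have Ip' := lcomm_y_mul p lg dx kN.
case: (lt_cardS (hp k)) => [hk|hk].
  by exists p'; split=> // j; rewrite /p'; case: eqP => // ->.
(* The raised exponent equals the order of [K], and (vi) lowers it to 1. *)
exists (fun j => if j == k then 1%N else p' j); split=> [j|].
  by rewrite /p'; case: eqP => // _; apply: lt_card1.
apply: (ideal_trans idI) Ip' _.
by apply: lcomm_y_reduce lg dx hk _ kN; rewrite /p' eqxx.
Qed.

Lemma lspan_xl_y l f k : l \in [:: g; g^-1%g] -> lspan (I `|` basis_xl l) f ->
  lspan (I `|` basis_xl l) (lie f (y k)).
Proof.
move=> lg; apply: lspan_lie => b [Ib|]; last exact: basis_xl_y.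
by apply: lspan_in; left; apply: ideal_liel.
Qed.

(** A bracket [[a, b]] acts as the commutator of the actions of [a] and [b], so stability under
    single variables extends to all of L(Y). *)
Lemma lspan_xl_Y l f w : l \in [:: g; g^-1%g] -> lspan (I `|` basis_xl l) f ->
  lspan (I `|` basis_xl l) (lie f (Yincl K G w)).
Proof.
move=> lg; have hom := @Yincl_hom K G.
elim/freeLie_ind: w f => [k||c a b IHa IHb|a b IHa IHb] f Sf.
- by rewrite Yincl_var; apply: lspan_xl_y.
- by rewrite lie_hom0 // lie0r; apply: lspan_0.
- rewrite lie_homD // lie_homZ // lieDr lieZr.
  by apply: lspanD; [apply/lspanZ/IHa|apply: IHb].
- rewrite lie_hom_br // lie_derr; apply: lspanD; first exact/IHb/IHa.
  exact/lspanN/IHa/IHb.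
Qed.

(** Including [I] among the spanning elements turns congruences modulo [I] into membership in the
    span. *)
Let W : set LXG :=
  I `|` (range (Yincl K G) `|` basis_x K g `|` basis_xx K g).

Lemma basis_xl_W l f : l \in [:: g; g^-1%g] -> (I `|` basis_xl l) f -> W f.
Proof.
move=> lg [If|[i [r [p [hp ->]]]]]; first by left.
by right; left; right; exists l, i, r, p.
Qed.

Lemma lspan_xl_xl f h : lspan (I `|` basis_xl g) f ->
  lspan (I `|` basis_xl g^-1%g) h -> lspan W (lie f h).
Proof.
move=> Sf Sh; apply: lspan_lie Sf => a [Ia|].
  by apply: lspan_in; left; apply: ideal_liel.
move=> [i [r [p [hp ->]]]]; rewrite lieC; apply: lspanN.
apply: lspan_lie Sh => b [Ib|].
  by apply: lspan_in; left; apply: ideal_liel.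
move=> [j [r' [q [hq ->]]]]; rewrite lieC; apply/lspanN/lspan_in; right; right.
(* [basis_xx] asks for one common length, so both factors are padded to the larger one. *)
rewrite (@lcomm_y_widen _ _ _ r (maxn r r')) ?leq_maxl //.
rewrite (@lcomm_y_widen _ _ _ r' (maxn r r')) ?leq_maxr //.
eexists i, j, _, _, _; split; last by reflexivity.
by move=> k _; split; apply: lt_card_widen.
Qed.

Lemma xvar_xl i l : basis_xl l (xvar K i l).
Proof. by exists i, 0%N, (fun=> 0%N). Qed.

(** The cases follow the degree [l]. Outside the support, (i) applies. For [l] equal to [g] or
    [g^-1], elements of L(Y) give [basis_xl] terms, [basis_x] terms vanish by (ii) or give
    [basis_xx] terms, and [basis_xx] terms vanish by (iii). For [l = 1], each summand is stable. *)
Lemma lspan_W_var f i l : lspan W f -> lspan W (lie f (xvar K i l)).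
Proof.
have gs : g \in [:: g; g^-1%g] by rewrite !inE eqxx.
have Vs : g^-1%g \in [:: g; g^-1%g] by rewrite !inE eqxx orbT.
have dx j m : deg m (xvar K j m) by exact: fl_deg_var.
have [l1|l1] := eqVneq l 1%g; last first.
  have [lg|lg] := boolP (l \in [:: g; g^-1%g]); last first.
    move=> _; apply: lspan_in; left; apply: ideal_lier => //.
    exact: rel_supp l1 lg (dx _ _).
  apply: lspan_lie => b [Ib|[[[w _ <-]|]|]].
  - by apply: lspan_in; left; apply: ideal_liel.
  - rewrite lieC; apply: lspanN.
    apply: (@lspan_sub _ _ (I `|` basis_xl l)) => [d /(basis_xl_W lg)|].
      exact: lspan_in.
    by apply: lspan_xl_Y lg _; apply: lspan_in; right; apply: xvar_xl.
  - move=> [m [j [r [p [mg hp ->]]]]].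
    have [<-|ml] := eqVneq m l.
      apply: lspan_in; left; apply: rel_same mg _ _; last exact: dx.
      by apply: fl_deg_lcomm_y.
    have Sm : lspan (I `|` basis_xl m) (lcomm_y (xvar K j m) r p).
      by apply: lspan_in; right; exists j, r, p.
    have Sl : lspan (I `|` basis_xl l) (xvar K i l).
      by apply: lspan_in; right; apply: xvar_xl.
    move: mg lg ml Sm Sl; rewrite !inE => /orP[]/eqP -> /orP[]/eqP ->;
      rewrite ?eqxx // => _ Sm Sl; first exact: lspan_xl_xl.
    by rewrite lieC; apply/lspanN/lspan_xl_xl.
  - move=> [j [k [r [p [q [_ ->]]]]]]; apply: lspan_in; left.
    have da : deg g (lcomm_y (xvar K j g) r p) by exact: fl_deg_lcomm_y.
    have db : deg g^-1%g (lcomm_y (xvar K k g^-1%g) r q) by exact: fl_deg_lcomm_y.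
    move: lg; rewrite !inE => /orP[]/eqP ->.
      exact: rel_lhl gs Vs g_neqV da db (dx _ _).
    (* In (iii) the outer degree repeats that of the left inner factor, so for [l = g^-1] the inner
       bracket is reversed first. *)
    rewrite [lie _ (lcomm_y (xvar K k _) _ _)]lieC lieNl; apply: (idealN idI).
    by apply: rel_lhl Vs gs _ db da (dx _ _); rewrite eq_sym g_neqV.
rewrite l1; apply: lspan_lie => b [Ib|[[[w _ <-]|]|]].
- by apply: lspan_in; left; apply: ideal_liel.
- apply: lspan_in; right; left; left; exists (lie w (fl_var K i)) => //.
  by rewrite (lie_hom_br _ _ (@Yincl_hom K G)) Yincl_var.
- move=> [m [j [r [p [mg hp ->]]]]].
  apply: (@lspan_sub _ _ (I `|` basis_xl m)) => [d /(basis_xl_W mg)|].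
    exact: lspan_in.
  by apply: basis_xl_y mg _; exists j, r, p.
- move=> [j [k [r [p [q [hpq ->]]]]]].
  have Sa : basis_xl g (lcomm_y (xvar K j g) r p).
    by exists j, r, p; split=> // n /hpq [].
  have Sb : basis_xl g^-1%g (lcomm_y (xvar K k g^-1%g) r q).
    by exists k, r, q; split=> // n /hpq [].
  (* The neutral variable acts as a derivation, hence on one factor at a time. *)
  rewrite lie_derl; apply: lspanD; apply: lspan_xl_xl.
  + exact: basis_xl_y.
  + by apply: lspan_in; right.
  + by apply: lspan_in; right.
  + exact: basis_xl_y.
Qed.

(** Expanding [[f, [a, b]]] as [[[f, a], b] - [[f, b], a]] reduces bracketing with any element to
    bracketing with variables. *)
Lemma lspan_W_lie f h : lspan W f -> lspan W (lie f h).
Proof.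
elim/freeLie_ind: h f => [[i l]||c a b IHa IHb|a b IHa IHb] f Sf.
- exact: lspan_W_var.
- by rewrite lie0r; apply: lspan_0.
- by rewrite lieDr lieZr; apply: lspanD; [apply/lspanZ/IHa|apply: IHb].
- rewrite lie_derr; apply: lspanD; first exact/IHb/IHa.
  exact/lspanN/IHa/IHb.
Qed.

Lemma lspan_W f : lspan W f.
Proof.
elim/freeLie_ind: f => [[i l]||c a b IHa IHb|a b IHa IHb].
- have [->|l1] := eqVneq l 1%g.
    apply: lspan_in; right; left; left; exists (fl_var K i) => //.
    by rewrite Yincl_var.
  apply: lspan_in; have [lg|lg] := boolP (l \in [:: g; g^-1%g]).
    by apply: (basis_xl_W lg); right; apply: xvar_xl.
  by left; apply: rel_supp l1 lg (fl_deg_var _ _ _).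
- exact: lspan_0.
- by apply: lspanD => //; apply: lspanZ.
- exact: lspan_W_lie.
Qed.

(** In a combination of elements of [W], the terms in [I] are absorbed by the congruence, and those
    from L(Y) merge into one [w] by linearity of [Yincl]. *)
Lemma normal_form f : exists w u,
  lspan (basis_x K g `|` basis_xx K g) u /\ I (f - (Yincl K G w + u)).
Proof.
have hom := @Yincl_hom K G.
elim: (lspan_W f) => [|c b {}f Wb _ [w [u [Su Iu]]]].
  by exists 0, 0; split; [apply: lspan_0|rewrite (lie_hom0 hom) addr0 subr0; apply: ideal0].
have xx b' : (basis_x K g `|` basis_xx K g) b' -> exists w u,
    lspan (basis_x K g `|` basis_xx K g) u /\ I (c *: b' + f - (Yincl K G w + u)).
  move=> Sb; exists w, (c *: b' + u); split; first by apply: lspan_cons.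
  by rewrite addrCA opprD addrACA subrr add0r.
case: Wb => [Ib|[[[v _ <-]|Sb]|Sb]].
- by exists w, u; split=> //; rewrite -addrA; apply: idealD => //; apply: idealZ.
- exists (c *: v + w), u; split=> //.
  by rewrite (lie_homD _ _ hom) (lie_homZ _ _ hom) -[_ + _ + u]addrA opprD addrACA subrr add0r.
- by apply: xx; left.
- by apply: xx; right.
Qed.

End Relations.

(** * Coordinates on UT_2 and UT_3, and powers in a finite field *)

Section UT3.
Variable K : fieldType.

Definition o20 : 'I_2 := @Ordinal 2 0 isT.
Definition o21 : 'I_2 := @Ordinal 2 1 isT.
Definition o30 : 'I_3 := @Ordinal 3 0 isT.
Definition o31 : 'I_3 := @Ordinal 3 1 isT.
Definition o32 : 'I_3 := @Ordinal 3 2 isT.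

Lemma sum_ord2 (F : 'I_2 -> K) : \sum_k F k = F o20 + F o21.
Proof. by rewrite !big_ord_recl big_ord0 addr0; do 2!f_equal; apply: val_inj. Qed.

Lemma sum_ord3 (F : 'I_3 -> K) : \sum_k F k = F o30 + F o31 + F o32.
Proof.
by rewrite !big_ord_recl big_ord0 addr0 addrA; do 2?f_equal; f_equal; apply: val_inj.
Qed.

Lemma ut_mx_subproof n (F : 'I_n -> 'I_n -> K) :
  (\matrix_(i, j) if (i <= j)%N then F i j else 0) \in @is_ut K n.
Proof. by apply/is_utP => i j ji; rewrite mxE leqNgt ji. Qed.

Definition ut2 (a b z : K) : ut K 2 :=
  Ut (ut_mx_subproof (fun i j => match val i, val j with
    | 0%N, 0%N => a | 1%N, 1%N => b | _, _ => z end)).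

Definition ut3 (a b c x y z : K) : ut K 3 :=
  Ut (ut_mx_subproof (fun i j => match val i, val j with
    | 0%N, 0%N => a | 1%N, 1%N => b | 2%N, 2%N => c
    | 0%N, 1%N => x | 1%N, 2%N => y | _, _ => z end)).

Lemma ut2P (A : ut K 2) :
  A = ut2 (ut_val A o20 o20) (ut_val A o21 o21) (ut_val A o20 o21).
Proof.
apply: val_inj; apply/matrixP => i j; rewrite /= mxE.
case: leqP => [|ji]; last exact: (is_utP _ (ut_valP A)).
case: i => -[|[|//]] hi; case: j => -[|[|//]] hj // _ /=;
  by congr (ut_val A _ _); apply: val_inj.
Qed.

Lemma ut3P (A : ut K 3) :
  A = ut3 (ut_val A o30 o30) (ut_val A o31 o31) (ut_val A o32 o32)
          (ut_val A o30 o31) (ut_val A o31 o32) (ut_val A o30 o32).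
Proof.
apply: val_inj; apply/matrixP => i j; rewrite /= mxE.
case: leqP => [|ji]; last exact: (is_utP _ (ut_valP A)).
case: i => -[|[|[|//]]] hi; case: j => -[|[|[|//]]] hj // _ /=;
  by congr (ut_val A _ _); apply: val_inj.
Qed.

Lemma ut2_lin k a b z a' b' z' :
  k *: ut2 a b z + ut2 a' b' z' = ut2 (k * a + a') (k * b + b') (k * z + z').
Proof. by rewrite [LHS]ut2P /= !mxE. Qed.

Lemma ut3_lin k a b c x y z a' b' c' x' y' z' :
  k *: ut3 a b c x y z + ut3 a' b' c' x' y' z' =
  ut3 (k * a + a') (k * b + b') (k * c + c') (k * x + x') (k * y + y') (k * z + z').
Proof. by rewrite [LHS]ut3P /= !mxE. Qed.

Lemma ut2_0 : 0 = ut2 0 0 0.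
Proof. by rewrite [LHS]ut2P /= !mxE. Qed.

Lemma ut3_0 : 0 = ut3 0 0 0 0 0 0.
Proof. by rewrite [LHS]ut3P /= !mxE. Qed.

Lemma ut2_lie a b z a' b' z' :
  lie (ut2 a b z) (ut2 a' b' z') = ut2 0 0 ((a - b) * z' - (a' - b') * z).
Proof.
rewrite [LHS]ut2P /= !mxE !sum_ord2 !mxE /=; congr ut2; ring.
Qed.

Lemma ut3_lie a b c x y z a' b' c' x' y' z' :
  lie (ut3 a b c x y z) (ut3 a' b' c' x' y' z') =
  ut3 0 0 0 ((a - b) * x' - (a' - b') * x) ((b - c) * y' - (b' - c') * y)
    ((a - c) * z' - (a' - c') * z + (x * y' - x' * y)).
Proof.
rewrite [LHS]ut3P /= !mxE !sum_ord3 !mxE /=; congr ut3; ring.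
Qed.

(** Right bracketing with the second matrix has [e_12] and [e_23] as eigenvectors modulo [e_13], and
    its [e_13] part contributes nothing because it commutes with both. *)
Lemma ut3_pow a b c x y z m :
  lie_pow (ut3 0 0 0 x y 0) (ut3 a b c 0 0 z) m =
  ut3 0 0 0 (x * (b - a) ^+ m) (y * (c - b) ^+ m) 0.
Proof.
elim: m => [|m IH] /=; first by rewrite !mulr1.
by rewrite IH ut3_lie !exprSr; congr ut3; ring.
Qed.

(** The map from UT_2 x K to the neutral component: [M] occupies rows and columns 1 and 3, and the
    [e_22] coefficient is the upper left entry of [N]. Encoding the factor K by a second UT_2 matrix
    lets both factors come from UT_2-valued homomorphisms. *)
Definition ut2_ut3 (M N : ut K 2) : ut K 3 :=
  ut3 (ut_val M o20 o20) (ut_val N o20 o20) (ut_val M o21 o21)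
      0 0 (ut_val M o20 o21).

Lemma ut2_ut3_hom (X : Type) (F H : freeLie K X -> ut K 2) :
  lie_hom F -> lie_hom H -> lie_hom (fun f => ut2_ut3 (F f) (H f)).
Proof.
move=> hF hH; split=> [k a b|a b].
  rewrite !(lie_homD _ _ hF, lie_homD _ _ hH, lie_homZ _ _ hF, lie_homZ _ _ hH).
  rewrite [F a]ut2P [F b]ut2P [H a]ut2P [H b]ut2P.
  rewrite /ut2_ut3 !ut2_lin ut3_lin /= !mxE /=; congr ut3; ring.
rewrite (lie_hom_br _ _ hF) (lie_hom_br _ _ hH).
rewrite [F a]ut2P [F b]ut2P [H a]ut2P [H b]ut2P.
rewrite /ut2_ut3 !ut2_lie ut3_lie /= !mxE /=; congr ut3; ring.
Qed.

Lemma card_eq_enum q : [set: K] #= `I_q ->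
  exists s : seq K, [/\ uniq s, size s = q & forall x, x \in s].
Proof.
move=> /card_set_bijP[f [ffun finj fsurj]].
have /choice[h hP] : forall i, exists x : K, (i < q)%N -> f x = i.
  move=> i; case: (ltnP i q) => iq; last by exists 0.
  by have [x _ <-] := fsurj i iq; exists x.
exists (map h (iota 0 q)); rewrite size_map size_iota; split=> //.
  rewrite map_inj_in_uniq ?iota_uniq // => i j.
  by rewrite !mem_iota !add0n => /hP {2}<- /hP {2}<- ->.
move=> x; have fxq : (f x < q)%N := ffun x I.
suff -> : x = h (f x) by rewrite map_f // mem_iota.
by apply: finj; rewrite ?inE // hP.
Qed.

(** Fermat's argument: multiplication by a nonzero [t] permutes the nonzero elements, so their
    product is unchanged by the factor [t ^+ q.-1], which is therefore 1. *)
Lemma expf_card_eq q (t : K) : [set: K] #= `I_q -> t ^+ q = t.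
Proof.
move=> Kq; have [->|t0] := eqVneq t 0.
  by rewrite expr0n; case: q Kq (@lt_card0 K) => // /[swap] /[apply].
have [s [us szs ms]] := card_eq_enum Kq.
pose s' := [seq x <- s | x != 0].
have us' : uniq s' by rewrite filter_uniq.
have ms' x : (x \in s') = (x != 0) by rewrite mem_filter ms andbT.
have p0 : \prod_(x <- s') x != 0.
  by rewrite prodf_seq_neq0; apply/allP => x; rewrite ms'.
have ss' : size s' = q.-1.
  have := count_predC (pred1 0) s; rewrite (count_uniq_mem _ us) ms szs.
  by rewrite size_filter => <-.
have tp : t ^+ q.-1 * \prod_(x <- s') x = \prod_(x <- s') x.
  have pt : perm_eq s' (map ( *%R t) s').
    apply: uniq_perm => //; first by rewrite map_inj_uniq //; apply: mulfI.
    move=> x; rewrite ms'; apply/idP/mapP => [x0|[z zs ->]].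
      by exists (t^-1 * x); rewrite ?ms' ?mulf_neq0 ?invr_eq0 // mulVKf.
    by rewrite mulf_neq0 // -ms'.
  rewrite -ss' [RHS](perm_big _ pt) /= big_map big_split /=.
  by rewrite big_const_seq count_predT iter_mulr_1.
rewrite -(prednK (lt_card0 Kq)) exprS.
by rewrite (mulIf p0 (etrans tp (esym (mul1r _)))) mulr1.
Qed.

End UT3.

(** * The grading on UT_3 and the validity of the generating identities *)

Section Soundness.
Variables (K : fieldType) (G : groupType) (g : G).
Hypothesis (G_abelian : forall a b : G, (a * b)%g = (b * a)%g).
Local Notation LXG := (freeLie K (nat * G)%type).
Local Notation D := (Gamma K g g^-1%g).

Lemma Gamma0 l : D l 0.
Proof. by move=> i j; rewrite /= mxE eqxx. Qed.

Lemma GammaP l c a b : D l a -> D l b -> D l (c *: a + b).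
Proof.
move=> ha hb i j; rewrite /= !mxE.
have [->|/ha //] := eqVneq (ut_val a i j) 0.
by rewrite mulr0 add0r => /hb.
Qed.

Lemma Gamma_ut3 l a b c x y z :
  D l (ut3 a b c x y z) <->
  [/\ a != 0 \/ b != 0 \/ c != 0 \/ z != 0 -> l = 1%g,
      x != 0 -> l = g & y != 0 -> l = g^-1%g].
Proof.
split=> [h|[h0 hx hy] i j].
  split; first (case=> [|[|[]]] /eqP n0).
  - by rewrite -(h o30 o30) // mxE; apply/eqP.
  - by rewrite -(h o31 o31) // mxE; apply/eqP.
  - by rewrite -(h o32 o32) // mxE; apply/eqP.
  - by rewrite -(h o30 o32) ?mxE /Gamma_deg ?mulgV //; apply/eqP.
  - by move=> n0; rewrite -(h o30 o31) // mxE.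
  - by move=> n0; rewrite -(h o31 o32) // mxE.
rewrite /= mxE /Gamma_deg mulgV.
case: i => -[|[|[|//]]] hi; case: j => -[|[|[|//]]] hj //=; rewrite ?eqxx //.
- by move=> n0; rewrite h0 //; left.
- by move=> n0; rewrite hx.
- by move=> n0; rewrite h0 //; right; right; right.
- by move=> n0; rewrite h0 //; right; left.
- by move=> n0; rewrite hy.
- by move=> n0; rewrite h0 //; right; right; left.
Qed.

Lemma Gamma_lie l m a b : D l a -> D m b -> D (l * m)%g (lie a b).
Proof.
(* A nonzero term forces [i <= k <= j] by triangularity, and along such a chain the degrees of
   matrix units multiply. *)
have mulD (A B : ut K 3) (l1 l2 : G) i j k : D l1 A -> D l2 B ->
    ut_val A i k * ut_val B k j != 0 -> Gamma_deg g g^-1%g i j = (l1 * l2)%g.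
  move=> hA hB; rewrite mulf_eq0 negb_or => /andP[ik kj].
  have leA : (i <= k)%N.
    by case: leqP ik => // ki; rewrite (is_utP _ (ut_valP A)) ?eqxx.
  have leB : (k <= j)%N.
    by case: leqP kj => // jk; rewrite (is_utP _ (ut_valP B)) ?eqxx.
  rewrite -(hA _ _ ik) -(hB _ _ kj) /Gamma_deg mulgV.
  move: leA leB {ik kj}; case: i => -[|[|[|//]]] hi; case: k => -[|[|[|//]]] hk //;
    case: j => -[|[|[|//]]] hj //= _ _; rewrite ?mulg1 ?mul1g ?mulgV //.
have sum_neq0 (F : 'I_3 -> K) : \sum_k F k != 0 -> exists k, F k != 0.
  apply: contraNP => /forallNP h; rewrite big1 // => k _.
  by apply/eqP; have /negP := h k; rewrite negbK.
move=> ha hb i j; rewrite /= !mxE.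
have [->|/sum_neq0[k nk] _] := eqVneq (\sum_k ut_val a i k * ut_val b k j) 0.
  rewrite sub0r oppr_eq0 => /sum_neq0[k nk].
  (* A nonzero entry from the reversed product has degree [m * l]; commutativity of [G] identifies
     it with [l * m]. *)
  by rewrite G_abelian; apply: mulD nk.
exact: mulD nk.
Qed.

Lemma Gamma_graded_lift (f : nat * G -> ut K 3) :
  (forall i l, D l (f (i, l))) -> graded_hom (@fl_deg K G) D (fl_lift f).
Proof.
by apply: graded_lift; [apply: Gamma0|apply: GammaP|apply: Gamma_lie].
Qed.

Lemma TG_ideal_Id : TG_ideal (Id_G D).
Proof.
split; first split.
- by move=> phi [h _]; rewrite lie_hom0.
- by move=> c a b Ia Ib phi gphi; rewrite gphi.1.1 Ia // Ib // scaler0 addr0.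
- by move=> a b Ia phi gphi; rewrite gphi.1.2 Ia // lie0l.
- move=> psi gpsi a Ia phi gphi.
  exact: Ia _ (graded_hom_comp gpsi gphi).
Qed.

Hypothesis g2_neq1 : (g ^+ 2)%g <> 1%g.

(** As [g ^+ 2] differs from 1, the degrees 1, [g] and [g^-1] are pairwise distinct, which separates
    the diagonal and [e_13] from [e_12] and from [e_23]. The next two lemmas use the same
    separation. *)
Lemma Gamma1E A : D 1%g A ->
  A = ut3 (ut_val A o30 o30) (ut_val A o31 o31) (ut_val A o32 o32)
          0 0 (ut_val A o30 o32).
Proof.
have gn : 1%g <> g by apply/eqP; rewrite eq_sym g_neq1.
have gVn : 1%g <> g^-1%g by apply/eqP; rewrite eq_sym gV_neq1.
rewrite {1 2}[A]ut3P => /Gamma_ut3[_ hx hy]; congr ut3; apply/eqP/contraT.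
- by move/hx.
- by move/hy.
Qed.

Lemma Gamma_gE A : D g A -> A = ut3 0 0 0 (ut_val A o30 o31) 0 0.
Proof.
have g1 : g <> 1%g by apply/eqP/g_neq1.
have gVn : g <> g^-1%g by apply/eqP/g_neqV.
rewrite {1 2}[A]ut3P => /Gamma_ut3[h0 _ hy]; congr ut3; apply/eqP/contraT => n0.
- by case: g1; apply: h0; left.
- by case: g1; apply: h0; right; left.
- by case: g1; apply: h0; right; right; left.
- by case: gVn; apply: hy.
- by case: g1; apply: h0; right; right; right.
Qed.

Lemma Gamma_gVE A : D g^-1%g A -> A = ut3 0 0 0 0 (ut_val A o31 o32) 0.
Proof.
have g1 : g^-1%g <> 1%g by apply/eqP/gV_neq1.
have gVn : g^-1%g <> g by apply/eqP; rewrite eq_sym g_neqV.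
rewrite {1 2}[A]ut3P => /Gamma_ut3[h0 hx _]; congr ut3; apply/eqP/contraT => n0.
- by case: g1; apply: h0; left.
- by case: g1; apply: h0; right; left.
- by case: g1; apply: h0; right; right; left.
- by case: gVn; apply: hx.
- by case: g1; apply: h0; right; right; right.
Qed.

(** Restricted to L(Y), a graded evaluation factors through UT_2 x K as a pair [F], [H] of
    evaluations in UT_2, and [w] vanishes under both. *)
Lemma Yincl_Id w : Id_UT K 2 w -> Id_G D (Yincl K G w).
Proof.
move=> Iw phi [hphi gphi].
pose A i := phi (yvar K G i).
have DA i : D 1%g (A i) by apply/gphi/fl_deg_var.
pose F := fl_lift (fun i =>
  ut2 (ut_val (A i) o30 o30) (ut_val (A i) o32 o32) (ut_val (A i) o30 o32)).
pose H := fl_lift (fun i => ut2 (ut_val (A i) o31 o31) 0 0).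
have FH : (phi \o Yincl K G) =1 (fun f => ut2_ut3 (F f) (H f)).
  move=> f; rewrite (fl_lift_unique (f := A)); last first.
  - by move=> i /=; rewrite Yincl_var.
  - exact: lie_hom_comp (@Yincl_hom K G) hphi.
  apply/esym/(fl_lift_unique (ut2_ut3_hom (fl_lift_hom _) (fl_lift_hom _))).
  by move=> i; rewrite /F /H !fl_lift_var [RHS]Gamma1E // /ut2_ut3 /= !mxE.
have := FH w; rewrite /= => ->.
rewrite !Iw; [|exact: fl_lift_hom|exact: fl_lift_hom].
by rewrite /ut2_ut3 /= !mxE -ut3_0.
Qed.

Lemma generators_Id : generators K g `<=` Id_G D.
Proof.
have gs : g \in [:: g; g^-1%g] by rewrite !inE eqxx.
move=> f hf phi gphi; have [hphi Dphi] := gphi.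
have Dx i l : D l (phi (xvar K i l)) by apply/Dphi/fl_deg_var.
have Dy i : D 1%g (phi (yvar K G i)) by apply: Dx.
move: hf => [[[[[[]|]|]|]|]|].
- move=> l lS ->; apply: contrapT => n0; apply: lS.
  by exists (phi (xvar K 0 l)) => //; apply/eqP.
- move=> [l lg ->]; rewrite (lie_hom_br _ _ hphi).
  move: lg; rewrite !inE => /orP[]/eqP ->.
    rewrite (Gamma_gE (Dx 0%N g)) (Gamma_gE (Dx 1%N g)) ut3_lie ut3_0.
    by congr ut3; ring.
  rewrite (Gamma_gVE (Dx 0%N g^-1%g)) (Gamma_gVE (Dx 1%N g^-1%g)) ut3_lie ut3_0.
  by congr ut3; ring.
- move=> [l [h [lg hg lh ->]]]; rewrite !(lie_hom_br _ _ hphi).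
  move: lg hg lh; rewrite !inE => /orP[]/eqP -> /orP[]/eqP ->; rewrite ?eqxx // => _.
    rewrite (Gamma_gE (Dx 0%N g)) (Gamma_gE (Dx 1%N g)) (Gamma_gVE (Dx 0%N g^-1%g)).
    by rewrite !ut3_lie ut3_0; congr ut3; ring.
  rewrite (Gamma_gE (Dx 0%N g)) (Gamma_gVE (Dx 1%N g^-1%g)) (Gamma_gVE (Dx 0%N g^-1%g)).
  by rewrite !ut3_lie ut3_0; congr ut3; ring.
- move=> [l lg ->]; rewrite !(lie_hom_br _ _ hphi).
  rewrite (Gamma1E (Dy 0%N)) (Gamma1E (Dy 1%N)).
  move: lg; rewrite !inE => /orP[]/eqP ->.
    by rewrite (Gamma_gE (Dx 0%N g)) !ut3_lie ut3_0; congr ut3; ring.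
  by rewrite (Gamma_gVE (Dx 0%N g^-1%g)) !ut3_lie ut3_0; congr ut3; ring.
- by move=> [w Iw <-]; apply: Yincl_Id.
- move=> [l [q [lg Kq ->]]].
  rewrite (lie_homB _ _ hphi) (lie_hom_pow _ _ _ hphi) (lie_hom_br _ _ hphi).
  apply/eqP; rewrite subr_eq0; apply/eqP; rewrite (Gamma1E (Dy 0%N)).
  move: lg; rewrite !inE => /orP[]/eqP ->.
    rewrite (Gamma_gE (Dx 0%N g)) ut3_pow ut3_lie !(expf_card_eq _ Kq).
    by congr ut3; ring.
  rewrite (Gamma_gVE (Dx 0%N g^-1%g)) ut3_pow ut3_lie !(expf_card_eq _ Kq).
  by congr ut3; ring.
Qed.

(** Sending all variables of nontrivial degree to 0 kills [u], while the neutral variables can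
    realise any evaluation [psi] in UT_2 inside the entries 11, 33 and 13. *)
Lemma Id_Yincl w u : Id_G D (Yincl K G w + u) ->
  lspan (basis_x K g `|` basis_xx K g) u -> Id_UT K 2 w.
Proof.
move=> Iwu Su psi hpsi.
pose M i := psi (fl_var K i).
pose f (v : nat * G) : ut K 3 := if v.2 == 1%g then ut2_ut3 (M v.1) 0 else 0.
have gphi : graded_hom (@fl_deg K G) D (fl_lift f).
  apply: Gamma_graded_lift => i l; rewrite /f /=; case: eqP => [->|_].
    by rewrite /ut2_ut3; apply/Gamma_ut3; split; rewrite ?eqxx.
  exact: Gamma0.
have hphi := gphi.1.
have x0 i l : l \in [:: g; g^-1%g] -> fl_lift f (xvar K i l) = 0.
  by move=> lg; rewrite fl_lift_var /f /= (negbTE (neq1_supp g2_neq1 lg)).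
have u0 : fl_lift f u = 0.
  elim: Su {Iwu} => [|c b {}u Sb _ IH]; first exact: lie_hom0.
  rewrite hphi.1 IH addr0; suff -> : fl_lift f b = 0 by rewrite scaler0.
  case: Sb => [[l [i [r [p [lg _ ->]]]]]|[i [j [r [p [q [_ ->]]]]]]].
    by rewrite lie_hom_lcomm_y0 // x0.
  rewrite (lie_hom_br _ _ hphi) lie_hom_lcomm_y0 ?lie0l //.
  by rewrite x0 // inE eqxx.
have h0 : lie_hom (fun _ : freeLie K nat => 0 : ut K 2).
  by split=> [c a b|a b]; rewrite ?scaler0 ?addr0 ?lie0l.
have E : (fl_lift f \o Yincl K G) w = ut2_ut3 (psi w) 0.
  rewrite (fl_lift_unique (f := fun i => ut2_ut3 (M i) 0)); last first.
  - by move=> i /=; rewrite Yincl_var fl_lift_var /f eqxx.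
  - exact: lie_hom_comp (@Yincl_hom K G) hphi.
  by apply/esym/(fl_lift_unique (ut2_ut3_hom hpsi h0)).
have := Iwu _ gphi; rewrite (lie_homD _ _ hphi) u0 addr0.
move: E => /= -> /(congr1 (@ut_val K 3)) /matrixP E.
rewrite [psi w]ut2P ut2_0; congr ut2.
- by have := E o30 o30; rewrite /= !mxE.
- by have := E o32 o32; rewrite /= !mxE.
- by have := E o30 o32; rewrite /= !mxE.
Qed.

End Soundness.

(** * Functionals dual to reduced monomials *)

Section MonomialDual.
Variable K : fieldType.

Lemma lt_card_inj M : lt_card K M -> exists z : 'I_M.+1 -> K, injective z.
Proof.
move=> hM.
suff [s us sM] : exists2 s : seq K, uniq s & (M < size s)%N.
  exists (fun i => nth 0 s i) => i j /eqP.
  by rewrite nth_uniq // ?(leq_trans (ltn_ord _)) // => /eqP /val_inj.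
have [[q Kq]|Kinf] := pselect (finite_set [set: K]).
  by have [s [us sq _]] := card_eq_enum Kq; exists s; rewrite // sq; apply: hM.
have [B _ MB] := infinite_set_fset M.+1 Kinf.
by exists (finmap.enum_fset B); [apply: finmap.fset_uniq|].
Qed.

(** The Vandermonde matrix of distinct points is invertible, and column [j] of its inverse supplies
    the weights. *)
Lemma power_dual D (z : 'I_D -> K) (j : 'I_D) : injective z ->
  exists c : 'I_D -> K, forall i, (i < D)%N ->
    \sum_t c t * z t ^+ i = (i == j)%:R.
Proof.
move=> zinj; pose V := Vandermonde D (\row_t z t).
have Vu : V \in unitmx.
  rewrite unitmxE det_Vandermonde unitfE prodf_seq_neq0.
  apply/allP => i _; rewrite prodf_seq_neq0; apply/allP => k _ /=.
  apply/implyP => ik; rewrite !mxE subr_eq0; apply/eqP => /zinj ki.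
  by rewrite ki ltnn in ik.
exists (fun t => invmx V t j) => i iD.
have /matrixP/(_ (Ordinal iD) j) := mulmxV Vu; rewrite !mxE => <-.
by apply: eq_bigr => t _; rewrite !mxE mulrC.
Qed.

(* The dual basis of the reduced monomials is the tensor power of the dual
   basis of 1, t, ..., t^(D-1). *)
Lemma monomial_dual N M (p0 : nat -> nat) : lt_card K M ->
    (forall k, (k < N)%N -> (p0 k <= M)%N) ->
  exists (T : finType) (w : T -> K) (a : T -> nat -> K),
    forall p, (forall k, (k < N)%N -> (p k <= M)%N) ->
      \sum_t w t * \prod_(k < N) a t k ^+ p k
      = [forall k : 'I_N, p k == p0 k]%:R.
Proof.
move=> /lt_card_inj[z zinj] hp0.
have /choice[c hc] : forall k : 'I_N, exists c : 'I_M.+1 -> K,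
    forall i, (i < M.+1)%N -> \sum_t c t * z t ^+ i = (i == p0 k)%:R.
  move=> k; have hk : (p0 k < M.+1)%N by rewrite ltnS hp0.
  exact: power_dual (Ordinal hk) zinj.
exists {ffun 'I_N -> 'I_M.+1}, (fun t : {ffun _ -> _} => \prod_k c k (t k)).
exists (fun (t : {ffun _ -> _}) k => if insub k is Some i then z (t i) else 0) => p hp.
under eq_bigr => t _.
  rewrite -big_split /=.
  under eq_bigr => k _ do rewrite valK.
  over.
(* Distributivity read backwards: the sum over all sample tuples factors into one-variable sums. *)
rewrite -(bigA_distr_bigA (fun k t => c k t * z t ^+ p k)) /=.
under eq_bigr => k _ do rewrite hc ?ltnS ?hp //.
case: forallP => [h|/forallP].
  by rewrite big1 // => k _; rewrite h.
rewrite negb_forall => /existsP[k /negbTE nk].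
by rewrite (bigD1 k) //= nk mul0r.
Qed.

End MonomialDual.

(** * Linear independence of the normal forms modulo the graded identities *)

Section Independence.
Variables (K : fieldType) (G : groupType) (g : G).
Hypothesis (G_abelian : forall a b : G, (a * b)%g = (b * a)%g).
Hypothesis g2_neq1 : (g ^+ 2)%g <> 1%g.
Local Notation LXG := (freeLie K (nat * G)%type).
Local Notation D := (Gamma K g g^-1%g).
Local Notation B := (basis_x K g `|` basis_xx K g).

(** One indexing for all three families, with a common length [N]: the options tell which of the two
    kinds of [x] occur and with which index. *)
Definition normal_elt N (o : option nat * option nat) (p q : nat -> nat) : LXG :=
  match o with
  | (Some i, None) => lcomm_y (xvar K i g) N p
  | (None, Some j) => lcomm_y (xvar K j g^-1%g) N q
  | (Some i, Some j) =>
      lie (lcomm_y (xvar K i g) N p) (lcomm_y (xvar K j g^-1%g) N q)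
  | (None, None) => 0
  end.

(** An absent factor gets zero exponents, so its monomial is 1 and one formula with both exponent
    vectors covers every family. *)
Definition exps_ok N M (o : option nat * option nat) (p q : nat -> nat) : Prop :=
  [/\ o != (None, None), (forall k, (k < N)%N -> (p k <= M)%N),
      (forall k, (k < N)%N -> (q k <= M)%N),
      (o.1 = None -> p = fun=> 0%N) & (o.2 = None -> q = fun=> 0%N)].

Lemma lt_card_max m n : lt_card K m -> lt_card K n -> lt_card K (maxn m n).
Proof. by move=> hm hn q Kq; rewrite gtn_max hm // hn. Qed.

Lemma lt_card_bound r (p : nat -> nat) : (forall k, (k < r)%N -> lt_card K (p k)) ->
  exists2 M, lt_card K M & forall k, (k < r)%N -> (p k <= M)%N.
Proof.
elim: r => [|r IH] hp; first by exists 0%N => //; apply: lt_card0.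
have [k kr|M hM pM] := IH; first by apply: hp; rewrite ltnS ltnW.
exists (maxn M (p r)); first by apply: lt_card_max => //; apply: hp.
move=> k; rewrite ltnS leq_eqVlt => /orP[/eqP ->|kr]; first exact: leq_maxr.
by rewrite leq_max pM.
Qed.

(** The description is given for all bounds beyond [N0] and [M0], so that finitely many elements can
    share the same [N] and [M]. *)
Lemma basis_normal_elt b : B b -> exists N0 M0, lt_card K M0 /\
  forall N M, (N0 <= N)%N -> (M0 <= M)%N ->
    exists o p q, exps_ok N M o p q /\ b = normal_elt N o p q.
Proof.
pose ext r (p : nat -> nat) k := if (k < r)%N then p k else 0%N.
have extP r p M0 M k : (forall k, (k < r)%N -> (p k <= M0)%N) -> (M0 <= M)%N ->
    (ext r p k <= M)%N.
  by rewrite /ext => hp MM; case: ifP => // /hp /leq_trans; apply.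
case=> [[l [i [r [p [lg hp ->]]]]]|[i [j [r [p [q [hpq ->]]]]]]].
  have [M0 hM pM] := lt_card_bound hp.
  exists r, M0; split=> // N M rN MM.
  move: lg; rewrite !inE => /orP[]/eqP ->.
    exists (Some i, None), (ext r p), (fun=> 0%N).
    by split; [split=> // k _; apply: extP pM _|apply: lcomm_y_widen].
  exists (None, Some i), (fun=> 0%N), (ext r p).
  by split; [split=> // k _; apply: extP pM _|apply: lcomm_y_widen].
have [M1 hM1 pM] := lt_card_bound (fun k kr => (hpq k kr).1).
have [M2 hM2 qM] := lt_card_bound (fun k kr => (hpq k kr).2).
exists r, (maxn M1 M2); split; first exact: lt_card_max.
move=> N M rN; rewrite geq_max => /andP[MM1 MM2].
exists (Some i, Some j), (ext r p), (ext r q); split.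
  by split=> // k _; [apply: extP pM _|apply: extP qM _].
by rewrite /normal_elt -!lcomm_y_widen.
Qed.

Lemma basis_normal_elt_seq (s : seq LXG) : (forall b, b \in s -> B b) ->
  exists N0 M0, lt_card K M0 /\
  forall N M, (N0 <= N)%N -> (M0 <= M)%N -> forall b, b \in s ->
    exists o p q, exps_ok N M o p q /\ b = normal_elt N o p q.
Proof.
elim: s => [|b s IH] hs; first by exists 0%N, 0%N; split=> //; apply: lt_card0.
have [N1 [M1 [hM1 h1]]] := IH (fun d ds => hs d (@mem_behead _ (b :: s) d ds)).
have [N2 [M2 [hM2 h2]]] := basis_normal_elt (hs b (mem_head b s)).
exists (maxn N1 N2), (maxn M1 M2); split; first exact: lt_card_max.
move=> N M; rewrite !geq_max => /andP[? ?] /andP[? ?] d.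
by rewrite inE => /orP[/eqP ->|ds]; [apply: h2|apply: h1].
Qed.

(** The signs make bracketing with [y k] multiply [e_12] by [a k] and [e_23] by [b k]. Only the
    variables with index [i0] in degree [g] and [j0] in degree [g^-1] survive among the [x]'s. *)
Definition diag_eval (i0 j0 : nat) (a b : nat -> K) (v : nat * G) : ut K 3 :=
  if v.2 == 1%g then ut3 (- a v.1) 0 (b v.1) 0 0 0
  else if v.2 == g then ut3 0 0 0 (v.1 == i0)%:R 0 0
  else if v.2 == g^-1%g then ut3 0 0 0 0 (v.1 == j0)%:R 0
  else 0.

Lemma diag_eval_graded i0 j0 a b : graded_hom (@fl_deg K G) D (fl_lift (diag_eval i0 j0 a b)).
Proof.
apply: Gamma_graded_lift => // i l; rewrite /diag_eval /=.
case: eqP => [->|_]; first by apply/Gamma_ut3; split; rewrite ?eqxx.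
case: eqP => [->|_].
  by apply/Gamma_ut3; split; rewrite ?eqxx //; do 3?case=> //.
case: eqP => [->|_]; last exact: Gamma0.
by apply/Gamma_ut3; split; rewrite ?eqxx //; do 3?case=> //.
Qed.

Lemma diag_eval_lcomm_y i0 j0 a b u x y N p :
    fl_lift (diag_eval i0 j0 a b) u = ut3 0 0 0 x y 0 ->
  fl_lift (diag_eval i0 j0 a b) (lcomm_y u N p) =
    ut3 0 0 0 (x * \prod_(k < N) a k ^+ p k) (y * \prod_(k < N) b k ^+ p k) 0.
Proof.
move=> hu; have hom := fl_lift_hom (diag_eval i0 j0 a b).
elim: N => [|N IH]; first by rewrite !big_ord0 !mulr1.
rewrite lcomm_yS (lie_hom_pow _ _ _ hom) IH fl_lift_var /diag_eval /= eqxx ut3_pow.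
by rewrite !big_ord_recr /= sub0r opprK subr0 !mulrA.
Qed.

Definition entry (o : option nat * option nat) (A : ut K 3) : K :=
  match o with
  | (Some _, None) => ut_val A o30 o31
  | (None, Some _) => ut_val A o31 o32
  | _ => ut_val A o30 o32
  end.

Lemma entryP o c A A' : entry o (c *: A + A') = c * entry o A + entry o A'.
Proof. by case: o => [[?|] [?|]]; rewrite /= !mxE. Qed.

(** The three families land in multiples of [e_12], [e_23] and [e_13], so the entry chosen by [o0]
    detects the family and the surviving variables detect the indices. *)
Lemma entry_diag_eval o o0 a b N M p q : o0 != (None, None) -> exps_ok N M o p q ->
  entry o0 (fl_lift (diag_eval (odflt 0%N o0.1) (odflt 0%N o0.2) a b) (normal_elt N o p q)) =
  (o == o0)%:R * (\prod_(k < N) a k ^+ p k * \prod_(k < N) b k ^+ q k).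
Proof.
move=> n0 [n p1 q1 p2 q2]; set i0 := odflt _ _; set j0 := odflt _ _.
have hom := fl_lift_hom (diag_eval i0 j0 a b).
have xg i : fl_lift (diag_eval i0 j0 a b) (xvar K i g) = ut3 0 0 0 (i == i0)%:R 0 0.
  by rewrite fl_lift_var /diag_eval /= (negbTE (g_neq1 g2_neq1)) eqxx.
have xV j : fl_lift (diag_eval i0 j0 a b) (xvar K j g^-1%g) = ut3 0 0 0 0 (j == j0)%:R 0.
  rewrite fl_lift_var /diag_eval /= (negbTE (gV_neq1 g2_neq1)) eqxx.
  by rewrite eq_sym (negbTE (g_neqV g2_neq1)).
have prod0 (c : nat -> K) : \prod_(k < N) c k ^+ 0 = 1 by rewrite big1.
have SomeE (k l : nat) : (Some k == Some l) = (k == l) by [].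
have pairE := (xpair_eqE, SomeE).
case: o n p2 q2 => [[i|] [j|]] //= n p2 q2.
- rewrite (lie_hom_br _ _ hom) (diag_eval_lcomm_y _ _ (xg i)) (diag_eval_lcomm_y _ _ (xV j)).
  rewrite ut3_lie; clear hom xg xV; case: o0 n0 @i0 @j0 => [[i0|] [j0|]] // _ /=;
  rewrite !mxE /= ?pairE -?mulnb ?natrM /=; ring.
- rewrite q2 // (diag_eval_lcomm_y _ _ (xg i)) prod0.
  clear hom xg xV; case: o0 n0 @i0 @j0 => [[i0|] [j0|]] // _ /=;
  rewrite !mxE /= ?pairE -?mulnb ?natrM /=; ring.
- rewrite p2 // (diag_eval_lcomm_y _ _ (xV j)) prod0.
  clear hom xg xV; case: o0 n0 @i0 @j0 => [[i0|] [j0|]] // _ /=;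
  rewrite !mxE /= ?pairE -?mulnb ?natrM /=; ring.
Qed.

Lemma basis_dual (s : seq LXG) b0 : (forall b, b \in s -> B b) -> b0 \in s ->
  exists F : LXG -> K,
    [/\ forall f, Id_G D f -> F f = 0,
        forall c f h, F (c *: f + h) = c * F f + F h
      & forall b, b \in s -> F b = (b == b0)%:R].
Proof.
move=> /basis_normal_elt_seq[N [M [hM /(_ N M (leqnn _) (leqnn _)) hs]]] b0s.
have [o0 [p0 [q0 [ok0 b0E]]]] := hs _ b0s.
have [n0 hp0 hq0 _ _] := ok0.
have [T [w [a ha]]] := monomial_dual hM hp0.
have [T' [w' [b hb]]] := monomial_dual hM hq0.
pose phi t t' := fl_lift (diag_eval (odflt 0%N o0.1) (odflt 0%N o0.2) (a t) (b t')).
(* The weights [w] and [w'] extract the coefficients of the monomials with exponents [p0] in the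
   [a]'s and [q0] in the [b]'s. As a combination of entries of graded evaluations, [F] vanishes on
   identities. *)
pose F f := \sum_t \sum_t' w t * w' t' * entry o0 (phi t t' f).
have Felt o p q : exps_ok N M o p q -> F (normal_elt N o p q) =
    [&& o == o0, [forall k : 'I_N, p k == p0 k] & [forall k : 'I_N, q k == q0 k]]%:R.
  move=> ok; have [_ hp hq _ _] := ok.
  rewrite -mulnb natrM -mulnb natrM -(ha _ hp) -(hb _ hq) big_distrlr /=.
  rewrite big_distrr; apply: eq_bigr => t _; rewrite /= big_distrr /=.
  apply: eq_bigr => t' _; rewrite (entry_diag_eval _ _ n0 ok); ring.
exists F; split.
- move=> f If; rewrite /F big1 // => t _; rewrite big1 // => t' _.
  rewrite If; last exact: diag_eval_graded.
  by rewrite /entry; case: (o0) => [[?|] [?|]]; rewrite /= mxE mulr0.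
- move=> c f h; rewrite /F big_distrr /= -big_split; apply: eq_bigr => t _ /=.
  rewrite big_distrr -big_split; apply: eq_bigr => t' _ /=.
  rewrite /phi (fl_lift_hom _).1 entryP; ring.
move=> d ds; have [o [p [q [ok dE]]]] := hs _ ds.
have [->|/eqP ne] := eqVneq d b0.
  rewrite b0E Felt // eqxx.
  by do 2!(case: forallP => [_|[]//]).
rewrite dE Felt //; case: eqP => //= oo0; subst o0.
(* If all data agree, then [d = b0], a contradiction; agreement of exponents below [N] is enough, as
   the commutators see no others. *)
case: forallP => //= hp; case: forallP => //= hq; case: ne.
have pE (u : LXG) : lcomm_y u N p = lcomm_y u N p0.
  by apply: eq_lcomm_y => k kN; apply/eqP/(hp (Ordinal kN)).
have qE (u : LXG) : lcomm_y u N q = lcomm_y u N q0.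
  by apply: eq_lcomm_y => k kN; apply/eqP/(hq (Ordinal kN)).
by rewrite dE b0E /normal_elt; case: (o) => [[?|] [?|]]; rewrite ?pE ?qE.
Qed.

(** Setting the [x]'s to 0 isolates [w]; once [Yincl w] is known to be an identity it is subtracted,
    and the dual functional of each [b] reads off its coefficient. *)
Lemma basis_indep w (s : seq LXG) (c : LXG -> K) :
    uniq s -> (forall b, b \in s -> B b) ->
    Id_G D (Yincl K G w + \sum_(b <- s) c b *: b) ->
  Id_UT K 2 w /\ forall b, b \in s -> c b = 0.
Proof.
move=> us hs Iws.
have Iw : Id_UT K 2 w by apply: Id_Yincl Iws _ => //; apply: lspan_sum.
split=> // b0 b0s; have [F [F0 FP Fs]] := basis_dual hs b0s.
have Is : Id_G D (\sum_(b <- s) c b *: b).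
  rewrite -[X in Id_G _ X](addKr (Yincl K G w)) addrC.
  have idI := (TG_ideal_Id K g).1.
  by apply: (idealB idI Iws); apply: Yincl_Id.
have FS : F (\sum_(b <- s) c b *: b) = \sum_(b <- s) c b * F b.
  elim: (s) => [|b t IH]; last by rewrite !big_cons FP IH.
  by rewrite !big_nil F0 //; apply: ideal0; apply: (TG_ideal_Id K g).1.
move: FS; rewrite F0 // (bigD1_seq b0) //= Fs // eqxx mulr1 big_seq_cond big1.
  by rewrite addr0 => <-.
by move=> b /andP[bs /negbTE nb]; rewrite Fs // nb mulr0.
Qed.

End Independence.

(** * Generation of the identities and the basis *)

Theorem theorem3p12 (K : fieldType) (G : groupType)
    (G_abelian : forall a b : G, (a * b)%g = (b * a)%g)
    (g : G) (g2_neq1 : (g ^+ 2)%g <> 1%g) :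
  Id_G (Gamma K g (g^-1)%g) = TG_gen (generators K g) /\
  (forall B : set (freeLie K nat), basis_mod (Id_UT K 2) B ->
     basis_mod (Id_G (Gamma K g (g^-1)%g))
       (Yincl K G @` B `|` basis_x K g `|` basis_xx K g)).
Proof.
have TGI := TG_ideal_Id K g; have idI := TGI.1.
have homY := @Yincl_hom K G.
have gen_Id : TG_gen (generators K g) `<=` Id_G (Gamma K g g^-1%g).
  by move=> f; apply => //; apply: generators_Id.
have Id_gen : Id_G (Gamma K g g^-1%g) `<=` TG_gen (generators K g).
  have TGgen := TG_ideal_gen (generators K g).
  move=> f If; have [w [u [Su Ifu]]] :=
    normal_form g2_neq1 TGgen (@sub_TG_gen _ _ _) f.
  (* The normal form of an identity is again an identity. Independence then forces [u] to vanish and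
     [w] to be an identity of UT_2, which is a generator of type (v). *)
  have Iwu : Id_G (Gamma K g g^-1%g) (Yincl K G w + u).
    rewrite -[X in Id_G _ X](subKr f); apply: (idealB idI If); exact: gen_Id.
  have [s [c [us hs uE]]] := lspan_uniq Su; rewrite uE in Iwu Ifu.
  have [Iw c0] := basis_indep G_abelian g2_neq1 us hs Iwu.
  move: Ifu; rewrite big_seq big1 => [|b bs]; last first.
    by rewrite c0 // scale0r.
  rewrite addr0 => Ifw; rewrite -(subrK (Yincl K G w) f).
  apply: (idealD TGgen.1) => //.
  by apply: sub_TG_gen; left; right; exists w.
split; first by apply/seteqP.
move=> B [Bind Bspan]; split.
- move=> s c us hs Is.
  (* The list is split into commutators, to which [basis_indep] applies, and the remaining elements,
     which must come from [B]. *)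
  pose P b := `[< (basis_x K g `|` basis_xx K g) b >].
  pose s1 := [seq b <- s | P b]; pose s2 := [seq b <- s | ~~ P b].
  have s2B b : b \in s2 -> exists w, B w /\ Yincl K G w = b.
    rewrite mem_filter => /andP[/asboolPn nb /hs [[[w Bw <-]|hb]|hb]].
    + by exists w.
    + by case: nb; left.
    + by case: nb; right.
  have /choice[h hP] : forall b, exists w, b \in s2 -> B w /\ Yincl K G w = b.
    move=> b; have [/s2B[w hw]|nb] := boolP (b \in s2); first by exists w.
    by exists 0.
  pose t := map h s2.
  (* [h] picks preimages under [Yincl], so distinct elements of [s2] have distinct preimages. *)
  have ut : uniq t.
    rewrite map_inj_in_uniq ?filter_uniq // => a b /hP[_ {2}<-] /hP[_ {2}<-].
    by move=> ->.
  pose w := \sum_(v <- t) c (Yincl K G v) *: v.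
  have wE : Yincl K G w = \sum_(b <- s2) c b *: b.
    rewrite /w (lie_hom_sum _ (fun v => c (Yincl K G v)) homY) big_map.
    by apply: eq_big_seq => b /hP[_ ->].
  have Iws : Id_G (Gamma K g g^-1%g) (Yincl K G w + \sum_(b <- s1) c b *: b).
    by rewrite wE addrC !big_filter; move: Is; rewrite (bigID P).
  have hs1 b : b \in s1 -> (basis_x K g `|` basis_xx K g) b.
    by rewrite mem_filter => /andP[/asboolP].
  have [Iw c1] := basis_indep G_abelian g2_neq1 (filter_uniq _ us) hs1 Iws.
  have tB v : v \in t -> B v by case/mapP => b /hP[Bb _] ->.
  have ct := Bind t (fun v => c (Yincl K G v)) ut tB Iw.
  move=> b bs; have [Pb|nPb] := boolP (P b); first by apply: c1; rewrite mem_filter Pb.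
  have b2 : b \in s2 by rewrite mem_filter nPb.
  by have [_ {1}<-] := hP _ b2; apply: ct; apply: map_f.
- move=> f.
  (* For spanning, the normal form is taken modulo the graded identities themselves; [w] is then
     replaced by a combination of [B] modulo the identities of UT_2. *)
  have [w [u [Su Ifu]]] := normal_form g2_neq1 TGI
    (generators_Id g2_neq1) f.
  have [s [c [sB Iw]]] := Bspan w.
  have Sv : lspan (Yincl K G @` B `|` basis_x K g `|` basis_xx K g)
      (Yincl K G (\sum_(b <- s) c b *: b) + u).
    apply: lspanD.
      rewrite lie_hom_sum //; elim: s sB {Iw} => [|b s IH] sB.
        by rewrite big_nil; apply: lspan_0.
      rewrite big_cons; apply: lspan_cons.
        by left; left; exists b => //; apply: sB; rewrite mem_head.
      by apply: IH => d ds; apply: sB; rewrite mem_behead.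
    by apply: lspan_sub Su => b [bx|bxx]; apply: lspan_in; [left; right|right].
  have [s' [c' [_ hs' E]]] := lspan_uniq Sv.
  exists s', c'; split=> //; rewrite -E.
  apply: (ideal_trans idI) Ifu _.
  rewrite opprD addrACA subrr addr0 -lie_homB //.
  exact: Yincl_Id.
Qed.
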